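(* Let $\alpha\in(0,1)$, $a<T\le T^{\sharp}$ and $y^*\in\mathbb{R}$, and let $f:[a,T^{\sharp}]\times\mathbb{R}\to\mathbb{R}$ be continuous and bounded and satisfy a Lipschitz condition with respect to the second variable, i.e. there is $L\ge 0$ with $|f(t,u)-f(t,v)|\le L|u-v|$ for all $t\in[a,T^{\sharp}]$ and $u,v\in\mathbb{R}$. Let $y$ be the solution on $[a,T]$ of the terminal value problem $$D_{*a}^{\alpha} y(t) = f(t,y(t)), \qquad y(T)=y^*,$$ and, for $\tilde T$ with $T\le\tilde T\le T^{\sharp}$, let $\tilde y$ be the solution on $[a,\tilde T]$ of the terminal value problem $$D_{*a}^{\alpha}\tilde y(t) = f(t,\tilde y(t)), \qquad \tilde y(\tilde T)=y^*.$$ Then $$\sup_{t\in[a,T]}|y(t)-\tilde y(t)| = O\bigl(|T-\tilde T|^{\alpha}\bigr),$$ i.e. there is a constant $C$, depending on $\alpha,a,T,T^{\sharp},f,y^*$ but not on $\tilde T$, such that $\sup_{t\in[a,T]}|y(t)-\tilde y(t)|\le C|T-\tilde T|^{\alpha}$ for all $\tilde T\in[T,T^{\sharp}]$.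
   Context: For $\alpha\in(0,1)$ and a continuous function $y$ on $[a,b]$, the Caputo differential operator of order $\alpha$ with starting point $a$ is $$D_{*a}^{\alpha}y(t) = \frac{d}{dt}\,\frac{1}{\Gamma(1-\alpha)}\int_a^t (t-s)^{-\alpha}\,[y(s)-y(a)]\,ds.$$ A solution on $[a,b]$ of the terminal value problem $D_{*a}^{\alpha}y(t)=f(t,y(t))$, $y(b)=y^*$, is a continuous function $y$ on $[a,b]$ satisfying the differential equation on $(a,b]$ and the terminal condition $y(b)=y^*$. Existence and uniqueness of solutions to such terminal value problems is known from earlier literature. For continuous $f$, this problem is known to be equivalent, for continuous $y$, to the integral equation $y(t)=y^*+\frac{1}{\Gamma(\alpha)}\int_a^b G(t,s)f(s,y(s))\,ds$, $t\in[a,b]$, where $G(t,s)=-(b-s)^{\alpha-1}$ for $s>t$ and $G(t,s)=(t-s)^{\alpha-1}-(b-s)^{\alpha-1}$ for $s\le t$. *)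

(* Defs.v *)
From HB Require Import structures.
From mathcomp Require Import all_boot all_order all_algebra.
From mathcomp Require Import all_classical all_reals all_analysis.
Set Implicit Arguments.
Unset Strict Implicit.
Unset Printing Implicit Defensive.
Import Order.TTheory GRing.Theory Num.Theory.
Import numFieldNormedType.Exports.
Local Open Scope classical_set_scope.
Local Open Scope ring_scope.

(* Euler's integral; this is the Gamma function for x > 0. *)
Definition Gamma {R : realType} (x : R) : R :=
  Rintegral lebesgue_measure `]0, +oo[ (fun u => u `^ (x - 1) * expR (- u)).

(* For x an accumulation point of A, this is differentiability at x of F as a
   function on A only: one-sided at an endpoint of an interval A, two-sided at
   an interior point. *)
Definition is_derive_within {R : realType} (A : set R) (F : R -> R) (x l : R)
    : Prop :=
  (fun s => (F s - F x) / (s - x)) @ within A x^' --> l.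

(* The function whose derivative is the Caputo derivative. The value chosen by
   powR for the kernel at s = t is irrelevant to the Lebesgue integral. *)
Definition caputo_primitive {R : realType} (alpha a : R) (y : R -> R) (t : R)
    : R :=
  (Gamma (1 - alpha))^-1 *
  Rintegral lebesgue_measure `[a, t]
    (fun s => (t - s) `^ (- alpha) * (y s - y a)).

(* D_{*a}^alpha y exists at t and equals l, for y a function on [a, b]; the
   values of y outside [a, b] play no role, also when t = b. *)
Definition is_caputo_derive {R : realType} (alpha a b : R) (y : R -> R)
    (t l : R) : Prop :=
  is_derive_within `[a, b] (caputo_primitive alpha a y) t l.

Definition tvp_solution {R : realType} (alpha a b : R) (f : R -> R -> R)
    (ystar : R) (y : R -> R) : Prop :=
  [/\ {within `[a, b], continuous y},
      forall t, t \in `]a, b] -> is_caputo_derive alpha a b y t (f t (y t))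
    & y b = ystar].

(* Main.v *)
Require Import Defs.
From HB Require Import structures.
From mathcomp Require Import all_boot all_order all_algebra.
From mathcomp Require Import ring lra.
From mathcomp Require Import all_classical all_reals all_analysis.
From mathcomp Require Import measurable_realfun.
Import Order.TTheory GRing.Theory Num.Theory.
Import numFieldNormedType.Exports.
Local Open Scope classical_set_scope.
Local Open Scope ring_scope.

(** Write J_p g (t) for the Abel integral of (t - s)^(p - 1) g(s) over [a, t];
    this is [abel p g t a t] below.  Let y solve the equation on [a, b] and put
    g(s) = f(s, y(s)).

    Integrating the equation once gives J_(1-alpha) (y - y(a)) = Gamma(1-alpha)
    times the integral of g ([caputo_integrated]).  By Fubini's theorem
    J_p J_(1-p) is integration up to a beta constant ([abel_comp]), so this can
    be solved for y: y = y(a) + c J_alpha g for a constant c > 0 depending on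
    alpha only ([abel_inversion]).  In particular y is alpha-Hoelder, with a
    constant depending only on alpha and on a bound of f ([abel_hoelder]).

    Now let w = y - y' on [a, T].  Both solutions take the value ystar at their
    own terminal point, so |w(T)| = |y'(T') - y'(T)|, and this is at most a
    constant times |T - T'|^alpha by the Hoelder estimate.  It remains to bound
    w on all of [a, T] by its terminal value, in two steps.

    Forwards, |w(t)| <= |w(a)| + c L J_alpha |w| (t), and Gronwall's inequality
    for the Abel kernel gives |w| <= K |w(a)| ([abel_gronwall]).

    Backwards, |w(a)| <= D |w(T)| ([abel_lower_bound]): a solution of a scalar
    Caputo equation cannot decay too fast.  The reason is the minimum principle
    [abel_min_principle].  If w reaches its minimum over [a, t1] at t1, then the
    Caputo derivative of w at t1 is at most
    (w(t1) - w(a)) (t1 - a)^(-alpha) / Gamma(1-alpha), because the memory term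
    only sees values above w(t1).  On the other hand this derivative is
    f(t1, y(t1)) - f(t1, y'(t1)), hence at least - L |w(t1)|.  At the first time
    where w has decreased from w(a) > 0 to a small positive multiple of w(a),
    the two bounds are incompatible.

    The minimum principle needs w(s) - w(t1) = o((t1 - s)^alpha), slightly more
    than Hoelder continuity; this holds since g is continuous
    ([abel_little_o]). *)

Set Implicit Arguments.
Unset Strict Implicit.
Unset Printing Implicit Defensive.

(** * Integrals of the Abel kernel *)

Section kernel_integral.
Context {R : realType}.
Implicit Types p x c d : R.
Local Notation mu := (@lebesgue_measure R).

Lemma measurable_abel_kernel p x (D : set R) :
  measurable_fun D (fun s => (x - s) `^ p).
Proof.
apply: (@measurable_funTS _ _ _ _ D).
apply: (measurableT_comp (measurable_powR p)) => //.
exact: measurable_funB.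
Qed.

Lemma emeasurable_abel_kernel p x (D : set R) :
  measurable_fun D (fun s => ((x - s) `^ p)%:E).
Proof. by apply/measurable_EFinP; exact: measurable_abel_kernel. Qed.

Lemma is_derive_abel_primitive p x s : p != 0 -> s < x ->
  is_derive s 1 (fun s => - ((x - s) `^ p / p)) ((x - s) `^ (p - 1)).
Proof.
move=> p0 sx.
have xs : 0 < x - s by rewrite subr_gt0.
have H1 : is_derive s 1 (fun s => x - s) (-1).
  have := is_deriveB (is_derive_cst x s 1) (is_derive_id s 1).
  by rewrite sub0r.
have H2 := @is_derive1_comp R (@powR R ^~ p) (fun s => x - s) s _ _ (is_derive1_powR p xs) H1.
have := is_deriveZ (- p^-1) H2.
rewrite [X in is_derive _ _ X](_ : _ =
    (fun s => - ((x - s) `^ p / p))); last first.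
  by apply/funext => z; rewrite /= /GRing.scale/=; ring.
rewrite [X in is_derive _ _ _ X -> _](_ : _ = (x - s) `^ (p - 1)); first exact.
by rewrite /GRing.scale/=; field.
Qed.

(** Away from the singularity the kernel is continuous, and the fundamental
    theorem of calculus applies. *)
Lemma integral_abel_kernel_lt p x c d : 0 < p -> c <= d -> d < x ->
  (\int[mu]_(s in `[c, d]) ((x - s) `^ (p - 1))%:E =
   (((x - c) `^ p - (x - d) `^ p) / p)%:E)%E.
Proof.
move=> p0; rewrite le_eqVlt => /predU1P[->|cd] dx.
  by rewrite set_itv1 integral_set1 subrr mul0r.
have pn0 : p != 0 by rewrite gt_eqF.
have dF s : s <= d -> derivable (fun s => - ((x - s) `^ p / p)) s 1.
  by move=> sd; have [] := is_derive_abel_primitive pn0 (le_lt_trans sd dx).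
have cF s : s <= d -> {for s, continuous (fun s => - ((x - s) `^ p / p))}.
  by move=> sd; apply/differentiable_continuous/derivable1_diffP/dF.
rewrite (@continuous_FTC2 _ _ (fun s => - ((x - s) `^ p / p)) c d cd).
- by rewrite -EFinB; congr EFin; ring.
- apply: continuous_in_subspaceT => s /set_mem/=; rewrite in_itv/= => /andP[_ sd].
  have xs : 0 < x - s by rewrite subr_gt0 (le_lt_trans sd).
  have H1 : {for s, continuous (fun s => x - s)}.
    by move=> ?; apply: cvgB; [exact: cvg_cst|exact: cvg_id].
  have H2 : {for x - s, continuous (@powR R ^~ (p - 1))}.
    apply/differentiable_continuous/derivable1_diffP.
    by apply: derivable_powR; rewrite in_itv/= xs.
  exact: (@continuous_comp _ _ _ (fun s => x - s) (@powR R ^~ (p - 1)) s H1 H2).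
- split.
  + by move=> s; rewrite in_itv/= => /andP[_ /ltW /dF].
  + by apply: cvg_at_right_filter; apply: cF; exact: ltW.
  + by apply: cvg_at_left_filter; exact: cF.
- move=> s; rewrite in_itv/= => /andP[_ sd].
  rewrite derive1E.
  by have [_ ->] := is_derive_abel_primitive pn0 (lt_trans sd dx).
Qed.

(** When d = x the kernel may be unbounded at the right endpoint; the value is
    the monotone limit of the integrals over [c, x - (x - c) / (n + 1)]. *)
Lemma integral_abel_kernel p x c d : 0 < p -> c <= d -> d <= x ->
  (\int[mu]_(s in `[c, d]) ((x - s) `^ (p - 1))%:E =
   (((x - c) `^ p - (x - d) `^ p) / p)%:E)%E.
Proof.
move=> p0 cd; rewrite le_eqVlt => /predU1P[dx|]; last exact: integral_abel_kernel_lt.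
move: cd; rewrite {}dx le_eqVlt => /predU1P[->|cx].
  by rewrite set_itv1 integral_set1 subrr mul0r.
have xc : 0 < x - c by rewrite subr_gt0.
pose e n : R := (x - c) / n.+1%:R.
have e0 n : 0 < e n by rewrite divr_gt0.
have ele n : e n <= x - c by rewrite ler_pdivrMr// ler_peMr ?ler1n ?ltW.
have emono n m : (n <= m)%N -> e m <= e n.
  by move=> nm; rewrite ler_pM2l// lef_pV2 ?posrE// ler_nat.
have ecvg : e n @[n --> \oo] --> 0.
  rewrite -[X in _ --> X](mulr0 (x - c)).
  by apply: cvgM; [exact: cvg_cst|exact: cvg_harmonic].
have epcvg : e n `^ p @[n --> \oo] --> 0.
  have := powR_cvg0 p0; move=> /cvg_at_rightP; apply; split => //.
pose F n := `[c, x - e n]%classic.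
have UF : \bigcup_n F n = `[c, x[%classic.
  apply/seteqP; split => [s [n _]|s]/=; rewrite !in_itv/=.
    move=> /andP[]; rewrite !bnd_simp => cs sx.
    rewrite cs/=; apply: le_lt_trans sx _.
    by rewrite ltrBlDr ltrDl.
  move=> /andP[cs sx].
  have xs : 0 < x - s by rewrite subr_gt0.
  have [N _ /(_ N (leqnn N))/=] := cvgr_lt 0 ecvg _ xs.
  move=> eN; exists N => //=; rewrite /F /= in_itv/=; apply/andP; split; first exact: cs.
  by rewrite lerBrDr addrC -lerBrDr ltW.
rewrite -integral_itv_bndo_bndc; last first.
  exact: emeasurable_abel_kernel.
rewrite -UF subrr powR0 ?gt_eqF// subr0.
have H : (\int[mu]_(s in F n) ((x - s) `^ (p - 1))%:E @[n --> \oo] -->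
   \int[mu]_(s in \bigcup_n F n) ((x - s) `^ (p - 1))%:E)%E.
  apply: ge0_nondecreasing_set_cvg_integral => //.
  - move=> n m nm; rewrite subsetEset; apply: subset_itvl.
    by rewrite bnd_simp lerD2l lerN2 emono.
  - by move=> n; exact: measurable_itv.
  - by move=> n; exact: emeasurable_abel_kernel.
  - by move=> n s _; rewrite lee_fin powR_ge0.
have FE : (fun n => \int[mu]_(s in F n) ((x - s) `^ (p - 1))%:E)%E =
    (fun n => (((x - c) `^ p - e n `^ p) / p)%:E).
  apply/funext => n; rewrite integral_abel_kernel_lt//.
  - by rewrite subKr.
  - by rewrite lerBrDr addrC -lerBrDr.
  - by rewrite ltrBlDr ltrDl.
rewrite FE in H.
apply: (cvg_unique _ H); first exact: ereal_hausdorff.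
apply: cvg_EFin; first exact: nearW.
rewrite -[X in _ --> X / p]subr0.
apply: cvgM; last exact: cvg_cst.
by apply: cvgB => //; exact: cvg_cst.
Qed.

End kernel_integral.

(** * Affine changes of variable on the line *)

Section affine.
Context {R : realType}.
Local Notation mu := (@lebesgue_measure R).

(** The image of Lebesgue measure under t |-> c + l t, multiplied by l, has the
    same values as Lebesgue measure on half-open intervals. *)
Lemma ge0_integral_affine (c l : R) (f : R -> \bar R) : 0 < l ->
  measurable_fun [set: R] f -> (forall t, 0 <= f t)%E ->
  (\int[mu]_t f t = l%:E * \int[mu]_t f (c + l * t)%R)%E.
Proof.
move=> l0 mf f0.
pose phi : measurableTypeR R -> measurableTypeR R := fun t : R => c + l * t.
have mphi : measurable_fun setT phi.
  by apply: measurable_funD => //; apply: measurable_funM.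
pose k : {nonneg R} := NngNum (ltW l0).
have lE (A : set R) : measurable A ->
    mu A = mscale k (pushforward mu phi) A.
  move=> mA; apply: lebesgue_measure_unique => //= _ [[u v]] _ <-.
  rewrite /= /mscale/= /pushforward.
  have -> : phi @^-1` `]u, v]%classic = `](u - c) / l, (v - c) / l]%classic.
    apply/seteqP; split => t /=; rewrite !in_itv/= /phi.
      by rewrite ltr_pdivrMr// ler_pdivlMr// => /andP[H1 H2]; apply/andP; split; lra.
    by rewrite ltr_pdivrMr// ler_pdivlMr// => /andP[H1 H2]; apply/andP; split; lra.
  rewrite !lebesgue_measure_itv/= !lte_fin ltr_pM2r ?invr_gt0// ltrD2r.
  case: ifPn => _; last by rewrite mule0.
  by rewrite -!EFinD -EFinM; congr EFin; field; rewrite gt_eqF.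
have := ge0_integral_pushforward mphi mu measurableT mf (fun y _ => f0 y).
rewrite preimage_setT => <-.
apply: (etrans _ (@ge0_integral_mscale _ (measurableTypeR R) R _ _ measurableT k f mf (fun y _ => f0 y))).
by apply: eq_measure_integral => A mA _; exact: lE.
Qed.

Lemma ge0_integral_opp (f : R -> \bar R) :
  measurable_fun [set: R] f -> (forall t, 0 <= f t)%E ->
  (\int[mu]_t f t = \int[mu]_t f (- t)%R)%E.
Proof.
move=> mf f0.
transitivity (\int[pushforward mu (-%R : _ -> measurableTypeR R)]_t f t)%E.
  by apply: eq_measure_integral => A mA _; exact/esym/lebesgue_measureN.
by rewrite ge0_integral_pushforward.
Qed.

End affine.

(** * The beta constant and the positivity of the Gamma function *)

Section beta.
Context {R : realType}.
Implicit Types p q c x s t z : R.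
Local Notation mu := (@lebesgue_measure R).

(** Extending the kernel by 0 to the negative half-line makes it a function on
    the whole line, so that convolutions need no restriction of domains. *)
Definition pos_kernel p z : R := if 0 < z then z `^ (p - 1) else 0.

Lemma pos_kernel_ge0 p z : 0 <= pos_kernel p z.
Proof. by rewrite /pos_kernel; case: ifP => // _; exact: powR_ge0. Qed.

Lemma measurable_pos_kernel p : measurable_fun [set: R] (pos_kernel p).
Proof.
apply: measurable_fun_ifT => //.
  exact: measurable_fun_ltr.
Qed.

Lemma pos_kernelM p l z : 0 < l ->
  pos_kernel p (l * z) = l `^ (p - 1) * pos_kernel p z.
Proof.
move=> l0; rewrite /pos_kernel pmulr_rgt0//; case: ifPn => z0; last by rewrite mulr0.
by rewrite powRM// ltW.
Qed.

Lemma pos_kernel_ge1 p z : p <= 1 -> 0 < z <= 1 -> 1 <= pos_kernel p z.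
Proof.
move=> p1 /andP[z0 z1]; rewrite /pos_kernel z0.
by rewrite -[leLHS](powRr0 z); apply: ger_powR; [rewrite z0 z1|rewrite subr_le0].
Qed.

(** One of the two factors of the beta integrand is always evaluated at a point
    of [1/2, 1], so their product is at most twice their sum. *)
Lemma pos_kernel_le2 p z : 0 < p -> p <= 1 -> 2^-1 <= z -> pos_kernel p z <= 2.
Proof.
move=> p0 p1 z2.
have z0 : 0 < z by apply: lt_le_trans z2; rewrite invr_gt0.
rewrite /pos_kernel z0.
have [z1|z1] := leP z 1; last first.
  apply: (@le_trans _ _ 1); last by rewrite ler1n.
  by rewrite -[leRHS](powRr0 z); apply: ler_powR; [exact: ltW|rewrite subr_le0].
have -> : p - 1 = - (1 - p) by ring.
rewrite powRN -[leRHS]invrK lef_pV2 ?posrE ?powR_gt0 ?invr_gt0//.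
apply: le_trans z2 _; apply: ger1_powR; first by rewrite z0.
by rewrite gerBl ltW.
Qed.

(** Euler's beta integral B(p, 1 - p). *)
Definition abel_beta p : R :=
  \int[mu]_t (pos_kernel p (1 - t) * pos_kernel (1 - p) t).

Lemma measurable_conv_kernel p s x : measurable_fun [set: R]
  (fun t => (pos_kernel p (x - t) * pos_kernel (1 - p) (t - s))%:E).
Proof.
apply/measurable_EFinP; apply: measurable_funM.
- apply: (measurableT_comp (@measurable_pos_kernel p)) => //.
  exact: measurable_funB.
- apply: (measurableT_comp (@measurable_pos_kernel (1 - p))) => //.
  exact: measurable_funB.
Qed.

Lemma measurable_beta_integrand p : measurable_fun [set: R]
  (fun t => (pos_kernel p (1 - t) * pos_kernel (1 - p) t)%:E).
Proof.
have := measurable_conv_kernel p 0 1.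
by under eq_fun do rewrite subr0.
Qed.

Lemma integral_pos_kernel p c : 0 < p -> 0 <= c ->
  (\int[mu]_(t in `[0%R, c]) (pos_kernel p (c - t))%:E = (c `^ p / p)%:E)%E.
Proof.
move=> p0 c0; rewrite -integral_itv_bndo_bndc; last first.
  apply/measurable_EFinP; apply: (measurableT_comp (@measurable_pos_kernel p)) => //.
  exact: measurable_funB.
under eq_integral.
  move=> t /set_mem/=; rewrite in_itv/= => /andP[_ tc].
  rewrite /pos_kernel subr_gt0 tc; over.
rewrite integral_itv_bndo_bndc; last exact: emeasurable_abel_kernel.
rewrite integral_abel_kernel// subrr subr0 powR0 ?gt_eqF//.
by rewrite subr0.
Qed.

Lemma integral_pos_kernel01 p : 0 < p ->
  (\int[mu]_(t in `[0%R, 1%R]) (pos_kernel p t)%:E = (p^-1)%:E)%E.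
Proof.
move=> p0; rewrite integral_mkcond.
have mk : measurable_fun setT ((fun t : R => (pos_kernel p t)%:E) \_ `[0, 1]).
  apply/(measurable_restrictT _ _).1 => //.
  by apply/measurable_EFinP; apply: measurable_funTS; exact: measurable_pos_kernel.
have k0 t : (0 <= ((fun t : R => (pos_kernel p t)%:E) \_ `[0%R, 1%R]) t)%E.
  by apply: erestrict_ge0 => z _; rewrite lee_fin pos_kernel_ge0.
rewrite ge0_integral_opp// (@ge0_integral_affine _ (-1) 1)//; last first.
  by apply: (measurableT_comp mk).
have := integral_pos_kernel p0 (@ler01 R); rewrite powR1 mul1r => <-.
rewrite mul1e.
rewrite [RHS]integral_mkcond; apply: eq_integral => t _.
rewrite mul1r opprD opprK !patchE !mem_setE/= !in_itv/=.
by rewrite subr_ge0 gerBl andbC.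
Qed.

Lemma beta_integral_lty p : 0 < p < 1 ->
  (\int[mu]_t (pos_kernel p (1 - t) * pos_kernel (1 - p) t)%:E < +oo)%E.
Proof.
move=> /andP[p0 p1].
have q0 : 0 < 1 - p by rewrite subr_gt0.
have mk1 : measurable_fun (`[0, 1]%classic : set R) (fun t => (pos_kernel p (1 - t))%:E).
  apply/measurable_EFinP; apply: measurable_funTS.
  apply: (measurableT_comp (@measurable_pos_kernel p)) => //.
  exact: measurable_funB.
have mk2 : measurable_fun (`[0, 1]%classic : set R) (fun t => (pos_kernel (1 - p) t)%:E).
  by apply/measurable_EFinP; apply: measurable_funTS; exact: measurable_pos_kernel.
apply: (@le_lt_trans _ _ (\int[mu]_(t in `[0%R, 1%R])
   (2%:E * ((pos_kernel p (1 - t))%:E + (pos_kernel (1 - p) t)%:E)))%E).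
  rewrite [leRHS]integral_mkcond; apply: ge0_le_integral => //.
  - by move=> t _; rewrite lee_fin mulr_ge0 ?pos_kernel_ge0.
  - exact: measurable_beta_integrand.
  - apply/(measurable_restrictT _ _).1 => //.
    by apply: emeasurable_funM => //; exact: emeasurable_funD.
  - move=> t _; rewrite patchE mem_setE/= in_itv/=.
    case: ifPn => [/andP[t0 t1]|]; last first.
      rewrite negb_and -!ltNge lee_fin => /orP[t0|t1].
        by rewrite /pos_kernel (ltNge 0 t) (ltW t0)/= mulr0.
      by rewrite /pos_kernel subr_gt0 (ltNge t 1) (ltW t1)/= mul0r.
    rewrite lee_fin.
    have K1 := pos_kernel_ge0 p (1 - t); have K2 := pos_kernel_ge0 (1 - p) t.
    have [t2|t2] := leP t (2^-1).
      have := @pos_kernel_le2 p (1 - t) p0 (ltW p1).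
      by move=> /(_ ltac:(lra)) H; nra.
    have := @pos_kernel_le2 (1 - p) t q0 ltac:(lra) (ltW t2).
    by move=> H; nra.
rewrite ge0_integralZl//=; first last.
- by move=> t _; rewrite lee_fin addr_ge0 ?pos_kernel_ge0.
- exact: emeasurable_funD.
rewrite ge0_integralD//=; try by move=> t _; rewrite lee_fin pos_kernel_ge0.
by rewrite integral_pos_kernel// integral_pos_kernel01// -EFinD -EFinM ltry.
Qed.

Lemma abel_betaE p : 0 < p < 1 ->
  (\int[mu]_t (pos_kernel p (1 - t) * pos_kernel (1 - p) t)%:E =
   (abel_beta p)%:E)%E.
Proof.
move=> p01; rewrite /abel_beta /Rintegral fineK// ge0_fin_numE.
  exact: beta_integral_lty.
by apply: integral_ge0 => t _; rewrite lee_fin mulr_ge0 ?pos_kernel_ge0.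
Qed.

Lemma abel_beta_ge1 p : 0 < p < 1 -> 1 <= abel_beta p.
Proof.
move=> /[dup] /andP[p0 p1] p01; rewrite -lee_fin -abel_betaE//.
have -> : (1%:E = \int[mu]_(t in `]0%R, 1%R[) 1%:E)%E.
  rewrite integral_cst//= lebesgue_measure_itv/= lte_fin ltr01.
  by rewrite oppr0 adde0 mule1.
rewrite integral_mkcond; apply: ge0_le_integral => //.
- by move=> t _; apply: erestrict_ge0.
- by apply/(measurable_restrictT _ _).1.
- exact: measurable_beta_integrand.
- move=> t _; rewrite patchE mem_setE/= in_itv/=.
  case: ifPn => [/andP[t0 t1]|_]; last by rewrite lee_fin mulr_ge0 ?pos_kernel_ge0.
  rewrite lee_fin.
  have H1 := @pos_kernel_ge1 p (1 - t) (ltW p1) ltac:(lra).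
  have H2 := @pos_kernel_ge1 (1 - p) t ltac:(lra) ltac:(lra).
  nra.
Qed.

(** The exponents p - 1 and - p add up to - 1, which the Jacobian x - s of the
    substitution t = s + (x - s) u cancels: the convolution of the kernels of
    complementary orders is constant. *)
Lemma integral_conv_kernel p s x : 0 < p < 1 -> s < x ->
  (\int[mu]_t (pos_kernel p (x - t) * pos_kernel (1 - p) (t - s))%:E =
   (abel_beta p)%:E)%E.
Proof.
move=> p01 sx; have l0 : 0 < x - s by rewrite subr_gt0.
rewrite (@ge0_integral_affine _ s (x - s))//; first last.
- by move=> t; rewrite lee_fin mulr_ge0 ?pos_kernel_ge0.
- exact: measurable_conv_kernel.
rewrite -ge0_integralZl//; first last.
- by rewrite lee_fin ltW.
- by move=> t _; rewrite lee_fin mulr_ge0 ?pos_kernel_ge0.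
- apply/measurable_EFinP; apply: measurable_funM.
  + apply: (measurableT_comp (@measurable_pos_kernel p)) => //.
    by apply: measurable_funB => //; apply: measurable_funD => //; exact: measurable_funM.
  + apply: (measurableT_comp (@measurable_pos_kernel (1 - p))) => //.
    by apply: measurable_funB => //; apply: measurable_funD => //; exact: measurable_funM.
rewrite -abel_betaE//; apply: eq_integral => t _; rewrite -EFinM; congr EFin.
have -> : x - (s + (x - s) * t) = (x - s) * (1 - t) by ring.
have -> : s + (x - s) * t - s = (x - s) * t by ring.
rewrite !pos_kernelM//.
have : (x - s) * ((x - s) `^ (p - 1) * (x - s) `^ (1 - p - 1)) = 1.
  rewrite -powRD; last by rewrite (gt_eqF l0) implybT.
  have -> : p - 1 + (1 - p - 1) = -1 by ring.
  by rewrite powR_inv1 ?ltW// divff// gt_eqF.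
move=> E; rewrite -[RHS]mul1r -[X in _ = X * _]E; ring.
Qed.

(** Integrability comes from u^(p-1) near 0 and from exp(-u) at infinity, and
    the part over ]0, 1] alone is at least exp(-1).  The integral must be shown
    finite, since [Rintegral] is 0 otherwise. *)
Lemma Gamma_gt0 p : 0 < p < 1 -> 0 < Gamma p.
Proof.
move=> /andP[p0 p1]; rewrite /Gamma.
pose g u : R := u `^ (p - 1) * expR (- u).
have g0 u : 0 <= g u by rewrite mulr_ge0 ?powR_ge0 ?expR_ge0.
have mexp : measurable_fun [set: R] (fun u : R => expR (- u)).
  exact: measurableT_comp.
have mg : measurable_fun [set: R] (fun u => (g u)%:E).
  by apply/measurable_EFinP; apply: measurable_funM => //; exact: measurable_powR.
have lower : ((expR (- 1))%:E <= \int[mu]_(u in `]0%R, +oo[) (g u)%:E)%E.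
  apply: (@le_trans _ _ (\int[mu]_(u in `]0%R, 1%R]) (expR (- 1))%:E)%E).
    rewrite integral_cst//= lebesgue_measure_itv/= lte_fin ltr01.
    by rewrite oppr0 adde0 mule1.
  apply: (@le_trans _ _ (\int[mu]_(u in `]0%R, 1%R]) (g u)%:E)%E).
    apply: ge0_le_integral => //.
    - exact: measurable_funTS.
    - move=> u /=; rewrite in_itv/= => /andP[u0 u1]; rewrite lee_fin.
      have := @pos_kernel_ge1 p u (ltW p1); rewrite u0 u1 /pos_kernel u0 => /(_ isT) H.
      have E : expR (- 1) <= expR (- u) by rewrite ler_expR lerN2.
      by apply: le_trans E _; rewrite ler_peMl// expR_ge0.
  apply: ge0_subset_integral => //=.
  - exact: measurable_funTS.
  - by move=> u _; rewrite lee_fin.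
  - by move=> u /=; rewrite !in_itv/= andbT => /andP[].
have upper : (\int[mu]_(u in `]0%R, +oo[) (g u)%:E < +oo)%E.
  pose h u : \bar R := ((fun u : R => (pos_kernel p u)%:E) \_ `[0%R, 1%R] u + (expR (- u))%:E)%E.
  have mh1 : measurable_fun [set: R] ((fun u : R => (pos_kernel p u)%:E) \_ `[0%R, 1%R]).
    apply/(measurable_restrictT _ _).1 => //.
    by apply/measurable_EFinP; apply: measurable_funTS; exact: measurable_pos_kernel.
  have mh2 : measurable_fun [set: R] (fun u : R => (expR (- u))%:E).
    exact/measurable_EFinP.
  have h10 u : (0 <= ((fun u : R => (pos_kernel p u)%:E) \_ `[0%R, 1%R]) u)%E.
    by apply: erestrict_ge0 => z _; rewrite lee_fin pos_kernel_ge0.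
  apply: (@le_lt_trans _ _ (\int[mu]_(u in `]0%R, +oo[) h u)%E).
    apply: ge0_le_integral => //.
    - by move=> u _; rewrite lee_fin.
    - exact: measurable_funTS.
    - by apply: measurable_funTS; exact: emeasurable_funD.
    - move=> u /=; rewrite in_itv/= andbT => u0; rewrite /h patchE mem_setE/= in_itv/= (ltW u0)/=.
      have [u1|u1] := leP u 1.
        rewrite -EFinD lee_fin /pos_kernel u0.
        have E1 : expR (- u) <= 1 by rewrite expR_le1 oppr_le0 ltW.
        have E0 := expR_ge0 (- u); have := powR_ge0 u (p - 1); rewrite /g => P0.
        by rewrite -[leLHS]addr0 lerD// ler_piMr.
      rewrite add0e lee_fin /g ler_piMl ?expR_ge0//.
      by rewrite -[leRHS](powRr0 u) ler_powR ?ltW// subr_lt0.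
  rewrite /h ge0_integralD//=; first last.
  - exact: measurable_funTS.
  - exact: measurable_funTS.
  apply: lte_add_pinfty.
    apply: (@le_lt_trans _ _ (\int[mu]_(u in [set: R]) ((fun u : R => (pos_kernel p u)%:E) \_ `[0%R, 1%R]) u)%E).
      exact: ge0_subset_integral.
    by rewrite -integral_mkcond integral_pos_kernel01// ltry.
  apply: (@le_lt_trans _ _ (\int[mu]_(u in `]0%R, +oo[) (exponential_pdf 1 u)%:E)%E).
    apply: ge0_le_integral => //.
    - exact: measurable_funTS.
    - by apply/measurable_EFinP; apply: measurable_funTS; exact: measurable_exponential_pdf.
    - move=> u /=; rewrite in_itv/= andbT => u0.
      by rewrite exponential_pdfE ?(ltW u0)// mul1r mulN1r.
  apply: (@le_lt_trans _ _ (\int[mu]_u (exponential_pdf 1 u)%:E)%E).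
    apply: ge0_subset_integral => //=.
    - by apply/measurable_EFinP; exact: measurable_exponential_pdf.
    - by move=> u _; rewrite lee_fin exponential_pdf_ge0.
  by rewrite integral_exponential_pdf// ltry.
rewrite /Rintegral fine_gt0// upper andbT.
by apply: lt_le_trans lower; rewrite lte_fin expR_gt0.
Qed.

End beta.

(** * Integration against the Abel kernel *)

Section segment_integral.
Context {R : realType}.
Local Notation mu := (@lebesgue_measure R).
Implicit Types (f g : R -> R) (a b c d : R).

Lemma segment_subset a b c d : a <= c -> d <= b -> `[c, d]%classic `<=` `[a, b]%classic.
Proof. by move=> ac db; apply: subset_itv; rewrite bnd_simp. Qed.

Lemma measurable_segment c d : measurable (`[c, d]%classic : set (measurableTypeR R)).
Proof. exact: measurable_itv. Qed.

Lemma Rintegral_split a b c f : a <= c -> c <= b ->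
  mu.-integrable `[a, b] (EFin \o f) ->
  \int[mu]_(s in `[a, b]) f s =
  \int[mu]_(s in `[a, c]) f s + \int[mu]_(s in `[c, b]) f s.
Proof.
move=> ac cb fi.
have H := @Rintegral_itvB R f (BLeft a) (BRight b) c fi.
rewrite !bnd_simp in H; have {}H := H ac cb.
rewrite -[X in _ = _ + X]Rintegral_itv_obnd_cbnd -?H; first by ring.
apply: integrableS fi => //; apply: subset_itv; rewrite bnd_simp//.
Qed.

Lemma le_Rintegral_co c d f g :
  mu.-integrable `[c, d] (EFin \o f) -> mu.-integrable `[c, d] (EFin \o g) ->
  (forall s, c <= s < d -> f s <= g s) ->
  \int[mu]_(s in `[c, d]) f s <= \int[mu]_(s in `[c, d]) g s.
Proof.
move=> fi gi fg.
have S : `[c, d[%classic `<=` `[c, d]%classic by apply: subset_itv; rewrite bnd_simp.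
rewrite -2?Rintegral_itv_bndo_bndc.
- apply: le_Rintegral => //; first exact: integrableS fi.
    exact: integrableS gi.
- exact: integrableS gi.
- exact: integrableS fi.
Qed.

End segment_integral.

(** Up to the factor 1 / Gamma(p), the contribution of the times in [c, d] to
    the Riemann-Liouville integral of order p of g at x; the whole integral with
    starting point a is the case c = a, d = x.  It is locked because comparing
    two such integrals by unfolding them is slow. *)
HB.lock Definition abel {R : realType} (p : R) (g : R -> R) (x c d : R) : R :=
  \int[@lebesgue_measure R]_(s in `[c, d]) ((x - s) `^ (p - 1) * g s).

Section abel.
Context {R : realType}.
Local Notation mu := (@lebesgue_measure R).
Implicit Types (g h : R -> R) (p a b c d x M K : R).

(** The class of densities for which Abel integrals are handled; it is stable
    under the operations below, with explicit bounds. *)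
Definition bounded_meas a b M g :=
  measurable_fun (`[a, b]%classic : set R) g /\ forall s, a <= s <= b -> `|g s| <= M.

Lemma bounded_measS a b c d M g : a <= c -> d <= b ->
  bounded_meas a b M g -> bounded_meas c d M g.
Proof.
move=> ac db [mg gM]; split.
  by apply: measurable_funS mg => //; exact: segment_subset.
by move=> s /andP[cs sd]; apply: gM; rewrite (le_trans ac cs) (le_trans sd db).
Qed.

Lemma bounded_meas_cst a b K : bounded_meas a b `|K| (fun=> K).
Proof. by split => //; exact: measurable_cst. Qed.

Lemma bounded_measN a b M g : bounded_meas a b M g -> bounded_meas a b M (fun s => - g s).
Proof.
move=> [mg gM]; split; first exact: measurableT_comp.
by move=> s sab; rewrite normrN gM.
Qed.

Lemma bounded_measD a b M g M' g' : bounded_meas a b M g -> bounded_meas a b M' g' ->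
  bounded_meas a b (M + M') (fun s => g s + g' s).
Proof.
move=> [mg gM] [mg' gM']; split; first exact: measurable_funD.
by move=> s sab; rewrite (le_trans (ler_normD _ _))// lerD ?gM ?gM'.
Qed.

Lemma bounded_measZ a b M g K : bounded_meas a b M g ->
  bounded_meas a b (`|K| * M) (fun s => K * g s).
Proof.
move=> [mg gM]; split; first exact: measurable_funM.
by move=> s sab; rewrite normrM ler_wpM2l ?gM.
Qed.

Lemma continuous_bounded_meas a b g : {within `[a, b], continuous g} ->
  exists M, bounded_meas a b M g.
Proof.
move=> cg.
have [ab|ba] := leP a b; last first.
  exists 0; split; last by move=> s /andP[H1 H2]; have := le_lt_trans (le_trans H1 H2) ba; rewrite ltxx.
  by rewrite set_itv_ge ?bnd_simp -?ltNge//; exact: measurable_fun_set0.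
have cn : {within `[a, b], continuous (fun s => `|g s|)}.
  by move=> x; apply: continuous_comp; [exact: cg|exact: norm_continuous].
have [c _ Hc] := EVT_max ab cn.
exists `|g c|; split; last by move=> s sab; apply: Hc; rewrite in_itv/=.
by apply: subspace_continuous_measurable_fun.
Qed.

Lemma integrable_kernel p x c d : 0 < p -> d <= x ->
  mu.-integrable `[c, d] (EFin \o (fun s => (x - s) `^ (p - 1))).
Proof.
move=> p0 dx; have [cd|dc] := leP c d; last first.
  by rewrite set_itv_ge ?bnd_simp -?ltNge//; exact: integrable_set0.
apply/integrableP; split; first exact: emeasurable_abel_kernel.
under eq_integral do rewrite gee0_abs ?lee_fin ?powR_ge0//.
by rewrite integral_abel_kernel// ltry.
Qed.

Lemma integrable_abel p g x c d M : 0 < p -> d <= x -> bounded_meas c d M g ->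
  mu.-integrable `[c, d] (EFin \o (fun s => (x - s) `^ (p - 1) * g s)).
Proof.
move=> p0 dx [mg gM].
have K := integrable_kernel c p0 dx.
have gi : mu.-integrable `[c, d] (fun s => (M * (x - s) `^ (p - 1))%:E).
  have := integrableZl (measurable_segment c d) M K.
  by apply: eq_integrable => // s _ /=; rewrite EFinM.
apply: (le_integrable _ _ _ gi) => //.
- by apply/measurable_EFinP/measurable_funM => //; exact: measurable_abel_kernel.
- move=> s /=; rewrite in_itv/= => /gM sM.
  rewrite lee_fin !normrM mulrC ler_wpM2r//.
  by rewrite (le_trans sM)// ler_norm.
Qed.

Lemma bounded_meas_integrable a b M g : bounded_meas a b M g ->
  mu.-integrable `[a, b] (EFin \o g).
Proof.
move=> bg; have := @integrable_abel 1 g b a b M ltr01 (lexx _) bg.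
by apply: eq_integrable => // s _ /=; rewrite subrr powRr0 mul1r.
Qed.

Lemma Rintegral_kernel p x c d : 0 < p -> c <= d -> d <= x ->
  \int[mu]_(s in `[c, d]) ((x - s) `^ (p - 1)) = ((x - c) `^ p - (x - d) `^ p) / p.
Proof. by move=> p0 cd dx; rewrite /Rintegral integral_abel_kernel. Qed.

Lemma abel_cst p K x c d : 0 < p -> c <= d -> d <= x ->
  abel p (fun=> K) x c d = K * (((x - c) `^ p - (x - d) `^ p) / p).
Proof.
move=> p0 cd dx; rewrite !abel.unlock RintegralZr//; last exact: integrable_kernel.
by rewrite Rintegral_kernel// mulrC.
Qed.

Lemma abelD p g h x c d M N : 0 < p -> d <= x ->
  bounded_meas c d M g -> bounded_meas c d N h ->
  abel p (fun s => g s + h s) x c d = abel p g x c d + abel p h x c d.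
Proof.
move=> p0 dx bg bh; rewrite !abel.unlock -RintegralD//; last 2 first.
  exact: integrable_abel bg.
  exact: integrable_abel bh.
by apply: eq_Rintegral => s _; rewrite mulrDr.
Qed.

Lemma abelZ p g K x c d M : 0 < p -> d <= x -> bounded_meas c d M g ->
  abel p (fun s => K * g s) x c d = K * abel p g x c d.
Proof.
move=> p0 dx bg; rewrite !abel.unlock -RintegralZl//; last exact: integrable_abel bg.
by apply: eq_Rintegral => s _; rewrite mulrCA.
Qed.

Lemma abelN p g x c d M : 0 < p -> d <= x -> bounded_meas c d M g ->
  abel p (fun s => - g s) x c d = - abel p g x c d.
Proof.
move=> p0 dx bg; rewrite -mulN1r -(abelZ _ p0 dx bg).
by rewrite abel.unlock; apply: eq_Rintegral => s _; rewrite mulN1r.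
Qed.

Lemma eq_abel p g h x c d : (forall s, c <= s <= d -> g s = h s) ->
  abel p g x c d = abel p h x c d.
Proof. by rewrite abel.unlock => gh; apply: eq_Rintegral => s; rewrite inE/= in_itv/= => /gh ->. Qed.

Lemma abel_split p g x a c d M : 0 < p -> a <= c -> c <= d -> d <= x ->
  bounded_meas a d M g ->
  abel p g x a d = abel p g x a c + abel p g x c d.
Proof.
by move=> p0 ac cd dx bg; rewrite abel.unlock; apply: Rintegral_split => //; exact: integrable_abel bg.
Qed.

Lemma le_abel p g h x c d M N : 0 < p -> d <= x ->
  bounded_meas c d M g -> bounded_meas c d N h ->
  (forall s, c <= s <= d -> g s <= h s) -> abel p g x c d <= abel p h x c d.
Proof.
move=> p0 dx bg bh gh; rewrite abel.unlock; apply: le_Rintegral => //.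
- exact: integrable_abel bg.
- exact: integrable_abel bh.
- by move=> s /=; rewrite in_itv/= => /gh ?; rewrite ler_wpM2l ?powR_ge0.
Qed.

Lemma abel_le p g x c d M K : 0 < p -> c <= d -> d <= x -> bounded_meas c d M g ->
  (forall s, c <= s <= d -> g s <= K) ->
  abel p g x c d <= K * (((x - c) `^ p - (x - d) `^ p) / p).
Proof.
move=> p0 cd dx bg gK; rewrite -abel_cst//.
exact: (le_abel p0 dx bg (bounded_meas_cst _ _ _) gK).
Qed.

Lemma abel_ge p g x c d M K : 0 < p -> c <= d -> d <= x -> bounded_meas c d M g ->
  (forall s, c <= s <= d -> K <= g s) ->
  K * (((x - c) `^ p - (x - d) `^ p) / p) <= abel p g x c d.
Proof.
move=> p0 cd dx bg gK; rewrite -abel_cst//.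
exact: (le_abel p0 dx (bounded_meas_cst _ _ _) bg gK).
Qed.

Lemma ler_kernel p s t1 t2 : p <= 1 -> s < t1 -> t1 <= t2 ->
  (t2 - s) `^ (p - 1) <= (t1 - s) `^ (p - 1).
Proof.
move=> p1 st1 t12.
have H1 : 0 < t1 - s by rewrite subr_gt0.
have H2 : 0 < t2 - s by rewrite subr_gt0 (lt_le_trans st1).
have -> : p - 1 = - (1 - p) by ring.
rewrite !powRN lef_pV2 ?posrE ?powR_gt0//.
by apply: ge0_ler_powR; rewrite ?nnegrE ?subr_ge0 ?lerD2r// ltW // (lt_le_trans st1).
Qed.

(** When the evaluation point moves from t1 to t2 the weights of the past
    values decrease, so the loss is monotone in g and can be computed for a
    constant g. *)
Lemma abel_shift_le p g c d t1 t2 M K : 0 < p -> p <= 1 ->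
  c <= d -> d <= t1 -> t1 <= t2 -> bounded_meas c d M g ->
  (forall s, c <= s <= d -> g s <= K) ->
  abel p g t1 c d - abel p g t2 c d <=
  K * (((t1 - c) `^ p - (t1 - d) `^ p) / p - ((t2 - c) `^ p - (t2 - d) `^ p) / p).
Proof.
move=> p0 p1 cd dt1 t12 bg gK.
have dt2 := le_trans dt1 t12.
have H M' g' : bounded_meas c d M' g' -> abel p g' t1 c d - abel p g' t2 c d =
    \int[mu]_(s in `[c, d]) ((t1 - s) `^ (p - 1) * g' s - (t2 - s) `^ (p - 1) * g' s).
  by move=> bg'; rewrite !abel.unlock RintegralB//; exact: integrable_abel bg'.
rewrite mulrBr -!abel_cst// (H M)// (H `|K|); last exact: bounded_meas_cst.
have I M' g' : bounded_meas c d M' g' -> mu.-integrable `[c, d]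
    (EFin \o (fun s => (t1 - s) `^ (p - 1) * g' s - (t2 - s) `^ (p - 1) * g' s)).
  move=> bg'; rewrite [X in _.-integrable _ X](_ : _ =
    (fun s => ((t1 - s) `^ (p - 1) * g' s)%:E - ((t2 - s) `^ (p - 1) * g' s)%:E)%E).
    by apply: integrableB => //; exact: integrable_abel bg'.
  by apply/funext => s /=; rewrite EFinB.
(* the comparison of the kernels fails at s = t1, where 0 `^ (p - 1) = 0 *)
apply: le_Rintegral_co; [exact: I bg|exact: I (bounded_meas_cst _ _ _)|].
- move=> s /andP[cs sd]; rewrite -!mulrBl.
  apply: ler_wpM2l; last by apply: gK; rewrite cs ltW.
  by rewrite subr_ge0 ler_kernel// (lt_le_trans sd).
Qed.

(** One estimate behind both the Hoelder bound and its little-o refinement.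
    The remote past [a, u], where only |g| <= M is known, contributes the
    difference of p-th powers, which is linear in t2 - t1 when u < t1 is fixed;
    the recent past [u, t2], where g is within k of h, contributes the term in
    k. *)
Lemma abel_increment_le p g a u t1 t2 M (h k : R) : 0 < p -> p <= 1 ->
  a <= u -> u <= t1 -> t1 <= t2 -> bounded_meas a t2 M g -> `|h| <= M ->
  (forall s, u <= s <= t2 -> h - k <= g s <= h + k) ->
  abel p g t1 a t1 - abel p g t2 a t2 <=
  (2 * k * (t2 - t1) `^ p + 2 * M * ((t2 - u) `^ p - (t1 - u) `^ p)) / p.
Proof.
move=> p0 p1 au ut1 t12 bg hM gh.
have ut2 := le_trans ut1 t12; have at1 := le_trans au ut1.
have pn0 : p != 0 by rewrite gt_eqF.
have bg1 : bounded_meas a t1 M g by exact: bounded_measS bg.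
have bgu : bounded_meas a u M g by exact: bounded_measS bg.
have k0 : 0 <= k.
  have := gh t2; rewrite ut2 lexx => /(_ isT)/andP[/le_trans] /[apply].
  by rewrite lerD2l => kk; rewrite -(pmulrn_lge0 _ (ltn0Sn 1)) mulr2n -lerBlDl sub0r.
rewrite (@abel_split p g t1 a u t1 M)// (@abel_split p g t2 a t1 t2 M)//.
rewrite (@abel_split p g t2 a u t1 M)//.
have H1 := @abel_shift_le p g a u t1 t2 M M p0 p1 au ut1 t12 bgu.
have H2 := @abel_shift_le p g u t1 t1 t2 M (h + k) p0 p1 ut1 (lexx _) t12.
have H3 := @abel_ge p g t2 t1 t2 M (h - k) p0 t12 (lexx _).
have /H1{}H1 : forall s, a <= s <= u -> g s <= M.
  move=> s /andP[sa su]; apply: le_trans (ler_norm _) _.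
  by apply: bg.2; rewrite sa (le_trans su ut2).
have /H2{}H2 : bounded_meas u t1 M g by exact: bounded_measS bg.
have /H2{}H2 : forall s, u <= s <= t1 -> g s <= h + k.
  move=> s /andP[us st1]; have := gh s; rewrite us (le_trans st1 t12).
  by move=> /(_ isT)/andP[].
have /H3{}H3 : bounded_meas t1 t2 M g by exact: bounded_measS bg.
have /H3{}H3 : forall s, t1 <= s <= t2 -> h - k <= g s.
  move=> s /andP[us st2]; have := gh s; rewrite st2 (le_trans ut1 us).
  by move=> /(_ isT)/andP[].
have M0 : 0 <= M by exact: le_trans hM.
have Emono (x y : R) : 0 <= x -> x <= y -> x `^ p <= y `^ p.
  by move=> x0 xy; apply: ge0_ler_powR; rewrite ?nnegrE ?(le_trans x0 xy)// ltW.
have E1 : (t1 - u) `^ p <= (t2 - u) `^ p by apply: Emono; [rewrite subr_ge0|rewrite lerD2r].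
have E2 : (t1 - a) `^ p <= (t2 - a) `^ p by apply: Emono; [rewrite subr_ge0|rewrite lerD2r].
have Z z : (z - z) `^ p = 0 by rewrite subrr powR0.
move: H1 H2 H3; rewrite !Z !subr0 => H1 H2 H3.
move: H1 H2 H3 E1 E2.
set A1 := (t1 - a) `^ p; set A2 := (t2 - a) `^ p.
set U1 := (t1 - u) `^ p; set U2 := (t2 - u) `^ p; set T := (t2 - t1) `^ p.
move=> H1 H2 H3 E1 E2.
have hM' : - M <= h by rewrite lerNl (le_trans _ hM)// -normrN ler_norm.
have S : M * ((A1 - U1) / p - (A2 - U2) / p) + (h + k) * (U1 / p - (U2 - T) / p)
   - (h - k) * (T / p) <= (2 * k * T + 2 * M * (U2 - U1)) / p.
  rewrite -subr_ge0.
  have -> : (2 * k * T + 2 * M * (U2 - U1)) / p - (M * ((A1 - U1) / p - (A2 - U2) / p)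
    + (h + k) * (U1 / p - (U2 - T) / p) - (h - k) * (T / p)) =
    (M * (A2 - A1) + (M + h + k) * (U2 - U1)) / p by field.
  apply: divr_ge0; last exact: ltW.
  have Mh : 0 <= M + h + k by rewrite addr_ge0// -lerBlDl sub0r.
  by rewrite addr_ge0// mulr_ge0// subr_ge0.
apply: le_trans S; apply: le_trans (lerB (lerD H1 H2) H3).
move: (abel _ _ _ _ _) (abel _ _ _ _ _) (abel _ _ _ _ _) (abel _ _ _ _ _) (abel _ _ _ _ _).
by move=> x1 x2 x3 x4 x5; rewrite le_eqVlt; apply/orP; left; apply/eqP; ring.
Qed.

(** The previous estimate with u = t1: on [t1, t2] the density lies within M of
    the constant 0. *)
Lemma abel_hoelder p g a t1 t2 M : 0 < p -> p <= 1 -> a <= t1 -> t1 <= t2 ->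
  bounded_meas a t2 M g ->
  `|abel p g t2 a t2 - abel p g t1 a t1| <= 4 * M / p * (t2 - t1) `^ p.
Proof.
move=> p0 p1 at1 t12 bg.
have at2 := le_trans at1 t12.
have M0 : 0 <= M by apply: le_trans (bg.2 a _); rewrite ?lexx.
have H g' : bounded_meas a t2 M g' -> 
  abel p g' t1 a t1 - abel p g' t2 a t2 <= 4 * M / p * (t2 - t1) `^ p.
  move=> bg'; have := @abel_increment_le p g' a t1 t1 t2 M 0 M p0 p1 at1 (lexx _) t12 bg'.
  have Z : (t1 - t1) `^ p = 0 by rewrite subrr powR0// gt_eqF.
  rewrite normr0 Z subr0 => /(_ M0).
  have gM s : t1 <= s <= t2 -> 0 - M <= g' s <= 0 + M.
    move=> /andP[H1 H2]; rewrite sub0r add0r -ler_norml.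
    by apply: bg'.2; rewrite H2 (le_trans at1).
  move=> /(_ gM) /le_trans; apply.
  by rewrite [leRHS](_ : _ = (2 * M * (t2 - t1) `^ p + 2 * M * (t2 - t1) `^ p) / p)//; ring.
have H1 := H _ bg; have := H _ (bounded_measN bg).
rewrite (abelN p0 (lexx _) bg) (abelN p0 (lexx _) (bounded_measS (lexx _) t12 bg)).
move=> H2; rewrite ler_norml lerNl opprB H1/=.
by rewrite opprK addrC in H2.
Qed.

End abel.

(** * Composing two Abel integrals of complementary orders *)

Section composition.
Context {R : realType}.
Local Notation mu := (@lebesgue_measure R).
Implicit Types (g : R -> R) (p a b s t x M : R).

Lemma pos_kernelE p (z : R) : p != 1 -> 0 <= z -> pos_kernel p z = z `^ (p - 1).
Proof.
move=> p1; rewrite le_eqVlt /pos_kernel => /predU1P[<-|->//].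
by rewrite ltxx powR0// subr_eq0.
Qed.

Lemma pos_kernel_eq0 p (z : R) : z <= 0 -> pos_kernel p z = 0.
Proof. by move=> z0; rewrite /pos_kernel ltNge z0. Qed.

(** The convolution of the extended kernels, as a function of s on the whole
    line: a multiple of the indicator of s < x. *)
Lemma integral_conv_kernelE p s x : 0 < p < 1 ->
  (\int[mu]_t (pos_kernel p (x - t) * pos_kernel (1 - p) (t - s))%:E =
   (abel_beta p * (s < x)%R%:R)%:E)%E.
Proof.
move=> p01; case: ltP => sx; first by rewrite mulr1 integral_conv_kernel.
rewrite mulr0 integral0_eq// => t _; congr EFin.
have [tx|xt] := leP t x; last by rewrite pos_kernel_eq0 ?mul0r// subr_le0 ltW.
by rewrite (@pos_kernel_eq0 (1 - p)) ?mulr0// subr_le0 (le_trans tx).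
Qed.

Lemma conv_kernel_ge0 p q s t x : 0 <= @pos_kernel R p (x - t) * pos_kernel q (t - s).
Proof. by rewrite mulr_ge0 ?pos_kernel_ge0. Qed.

Section fubini.
Variables (p a b x M : R) (g : R -> R).
Hypotheses (p01 : 0 < p < 1) (xb : x <= b) (bg : bounded_meas a b M g).

Let G : R -> R := g \_ `[a, b].
Let F (z : measurableTypeR R * measurableTypeR R) : \bar R :=
  (pos_kernel p (x - z.1) * pos_kernel (1 - p) (z.1 - z.2) * G z.2)%:E.

Let mG : measurable_fun [set: R] G.
Proof. by apply/(measurable_restrictT _ _).1 => //; exact: bg.1. Qed.

Let mF : measurable_fun setT F.
Proof.
apply/measurable_EFinP; apply: measurable_funM; last first.
  by apply: (measurableT_comp mG); exact: measurable_snd.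
apply: measurable_funM.
  apply: (measurableT_comp (@measurable_pos_kernel R p)) => //.
  by apply: measurable_funB => //; exact: measurable_fst.
apply: (measurableT_comp (@measurable_pos_kernel R (1 - p))) => //.
exact: measurable_funB.
Qed.

Let absF s : (\int[mu]_t `|F (t, s)| = (abel_beta p * (s < x)%R%:R * `|G s|)%:E)%E.
Proof.
rewrite EFinM -integral_conv_kernelE// -ge0_integralZr//.
- by apply: eq_integral => t _; rewrite /F/= normrM (ger0_norm (conv_kernel_ge0 _ _ _ _ _)).
- exact: measurable_conv_kernel.
- by move=> t _; rewrite lee_fin conv_kernel_ge0.
Qed.

Let F_integrable : (mu \x mu)%E.-integrable setT F.
Proof.
apply/(integrable21ltyP _ _ mF).
under eq_integral do rewrite absF.
have B0 : 0 <= abel_beta p by rewrite (le_trans ler01)// abel_beta_ge1.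
apply: (@le_lt_trans _ _ (\int[mu]_(s in `[a, b]) (abel_beta p * M)%:E)%E).
  rewrite [leRHS]integral_mkcond; apply: ge0_le_integral => //.
  - by move=> s _; rewrite lee_fin !mulr_ge0.
  - apply/measurable_EFinP; apply: measurable_funM; last exact: measurableT_comp.
    apply: measurable_funM => //.
    rewrite (_ : (fun s : R => (s < x)%R%:R) = \1_`]-oo, x[)//.
    by apply/funext => s; rewrite indicE mem_setE/= in_itv.
  - by apply/(measurable_restrictT _ _).1.
  - move=> s _; rewrite /G !patchE mem_setE/=; case: ifPn => sab; last first.
      by rewrite normr0 mulr0.
    rewrite lee_fin -mulrA ler_wpM2l//.
    have : `|g s| <= M by apply: bg.2; move: sab; rewrite in_itv.
    by case: ltP => _; rewrite ?mul1r ?mul0r// => /(le_trans (normr_ge0 _)).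
rewrite integral_cst//= lebesgue_measure_itv/=.
by case: ifPn => _; rewrite ?mule0 ?ltry// -EFinD -EFinM ltry.
Qed.

Let integral_fst t : (\int[mu]_s F (t, s) = 
  ((fun t => (((x - t) `^ (p - 1)) * abel (1 - p) g t a t)%:E) \_ `[a, x]) t)%E.
Proof.
move: p01 => /andP[p0 p1]; have q0 : 0 < 1 - p by rewrite subr_gt0.
rewrite patchE mem_setE/= in_itv/=.
case: ifPn => [/andP[at_ tx]|]; last first.
  rewrite negb_and -!ltNge => H; rewrite integral0_eq// => s _; rewrite /F/=.
  case/orP : H => [ta|xt]; last by rewrite (@pos_kernel_eq0 p) ?mul0r// subr_le0 ltW.
  have [st|ts] := leP s t; last by rewrite (@pos_kernel_eq0 (1 - p)) ?mulr0 ?mul0r// subr_le0 ltW.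
  by rewrite /G patchE mem_setE/= in_itv/= (leNgt a s) (le_lt_trans st ta)/= mulr0.
have I : mu.-integrable `[a, t] (EFin \o (fun s => (t - s) `^ (1 - p - 1) * g s)).
  by apply: integrable_abel => //; apply: bounded_measS bg => //; exact: le_trans xb.
rewrite EFinM abel.unlock /Rintegral fineK; last exact: integrable_fin_num.
rewrite -integralZl// [RHS]integral_mkcond; apply: eq_integral => s _.
rewrite patchE mem_setE/= in_itv/= /F/=.
have xt0 : 0 <= x - t by rewrite subr_ge0.
rewrite (pos_kernelE _ xt0) ?lt_eqF//.
case: ifPn => [/andP[as_ st]|].
  rewrite pos_kernelE ?subr_ge0//; last by rewrite lt_eqF// gtrBl.
  by rewrite /G patchE mem_setE/= in_itv/= as_ (le_trans st (le_trans tx xb))/= -mulrA -EFinM.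
rewrite negb_and -!ltNge => /orP[sa|ts]; last first.
  by rewrite (@pos_kernel_eq0 (1 - p)) ?mulr0 ?mul0r// subr_le0 ltW.
by rewrite /G patchE mem_setE/= in_itv/= (leNgt a s) sa/= mulr0.
Qed.

Let integral_snd s : (\int[mu]_t F (t, s) = 
  ((fun s => (abel_beta p * g s)%:E) \_ `[a, x[) s)%E.
Proof.
have -> : (\int[mu]_t F (t, s) = (abel_beta p * (s < x)%R%:R * G s)%:E)%E.
  rewrite EFinM -integral_conv_kernelE// -integralZr//.
  apply/integrableP; split; first exact: measurable_conv_kernel.
  under eq_integral do rewrite gee0_abs ?lee_fin ?conv_kernel_ge0//.
  by rewrite integral_conv_kernelE// ltry.
rewrite /G !patchE !mem_setE/= !in_itv/= -mulrA; case: ltP => sx.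
  rewrite mul1r (ltW (lt_le_trans sx xb)) !andbT.
  by case: ifP => // _; rewrite mulr0.
by rewrite mul0r mulr0 andbF.
Qed.

(** J_p J_(1-p) is integration, up to the beta constant: exchange the two
    integrals and use that the kernels of complementary orders convolve to a
    constant. *)
Lemma abel_comp :
  abel p (fun t => abel (1 - p) g t a t) x a x =
  abel_beta p * \int[mu]_(s in `[a, x]) g s.
Proof.
have mgx : bounded_meas a x M g by exact: bounded_measS bg.
have gi := bounded_meas_integrable mgx.
rewrite -RintegralZl//.
transitivity (fine (\int[mu]_t \int[mu]_s F (t, s))%E).
  rewrite {1}abel.unlock /Rintegral integral_mkcond.
  by congr fine; apply: eq_integral => t _; rewrite integral_fst.
rewrite (Fubini F_integrable) /Rintegral.
rewrite -integral_itv_bndo_bndc; last first.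
  apply/measurable_EFinP/measurable_funM => //.
  by apply: measurable_funS mgx.1 => //; apply: subset_itv; rewrite bnd_simp.
rewrite [in RHS]integral_mkcond.
by congr fine; apply: eq_integral => s _; rewrite integral_snd.
Qed.

End fubini.

End composition.

(** * Inversion of the Abel integral *)

Section inversion.
Context {R : realType}.
Local Notation mu := (@lebesgue_measure R).
Implicit Types (f g w v : R -> R) (p a b s t x M : R).

Lemma within_continuousP a b f : {within `[a, b], continuous f} <->
  forall x, a <= x <= b -> forall e, 0 < e -> exists2 d, 0 < d &
    forall s, a <= s <= b -> `|s - x| < d -> `|f s - f x| < e.
Proof.
split.
  move=> /subspace_continuousP cf x xab e e0.
  have /cf /cvgrPdist_lt /(_ _ e0) : `[a, b]%classic x by rewrite /= in_itv.
  rewrite near_withinE => -[d /= d0 H]; exists d => // s sab sx.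
  by rewrite distrC; apply: H; rewrite /= ?in_itv// distrC.
move=> H; apply/subspace_continuousP => x /=; rewrite in_itv/= => xab.
apply/cvgrPdist_lt => e e0; rewrite near_withinE.
have [d d0 Hd] := H x xab e e0; exists d => //= s /= sx.
by rewrite in_itv/= => sab; rewrite distrC; apply: Hd; rewrite // distrC.
Qed.

Lemma powR_small p (e : R) : 0 < p -> 0 < e -> exists2 d, 0 < d &
  forall z, 0 <= z < d -> z `^ p < e.
Proof.
move=> p0 e0; exists (e `^ p^-1); first exact: powR_gt0.
move=> z /andP[z0 zd].
have -> : e = (e `^ p^-1) `^ p by rewrite -powRrM mulVf ?gt_eqF// powRr1// ltW.
by apply: gt0_ltr_powR; rewrite ?nnegrE ?powR_ge0.
Qed.

Lemma hoelder_continuous a b p K f : 0 < p ->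
  (forall s t, a <= s -> s <= t -> t <= b -> `|f t - f s| <= K * (t - s) `^ p) ->
  {within `[a, b], continuous f}.
Proof.
move=> p0 H; apply/within_continuousP => x /andP[ax xb] e e0.
have K0 : 0 < `|K| + 1 by rewrite ltr_wpDl.
have [d d0 Hd] := powR_small p0 (divr_gt0 e0 K0); exists d => // s /andP[as_ sb] sxd.
have {}H : `|f s - f x| <= K * `|s - x| `^ p.
  have [sx|xs] := leP s x.
    by rewrite distrC [`|s - x|]distrC [`|x - s|]ger0_norm ?subr_ge0// H.
  by rewrite [`|s - x|]gtr0_norm ?subr_gt0// H// ltW.
apply: le_lt_trans H _.
have := Hd `|s - x|; rewrite normr_ge0 sxd => /(_ isT).
rewrite ltr_pdivlMr// mulrC => H; apply: le_lt_trans H.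
by rewrite ler_wpM2r ?powR_ge0// (le_trans (ler_norm _))// lerDl.
Qed.

Lemma abel_continuous p a b M g : 0 < p -> p <= 1 -> bounded_meas a b M g ->
  {within `[a, b], continuous (fun t => abel p g t a t)}.
Proof.
move=> p0 p1 bg; apply: (@hoelder_continuous _ _ p (4 * M / p)) => // s t as_ st tb.
by apply: abel_hoelder => //; exact: bounded_measS bg.
Qed.

Lemma Rintegral_ge_cst c d M K g : c <= d -> bounded_meas c d M g ->
  (forall s, c <= s <= d -> K <= g s) ->
  K * (d - c) <= \int[mu]_(s in `[c, d]) g s.
Proof.
move=> cd bg Kg.
have -> : K * (d - c) = \int[mu]_(s in `[c, d]) K.
  rewrite Rintegral_cst//= lebesgue_measure_itv/= lte_fin.
  by move: cd; rewrite le_eqVlt => /predU1P[->|cd]; [rewrite ltxx subrr|rewrite cd].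
apply: (le_Rintegral _ (bounded_meas_integrable (bounded_meas_cst c d K))
  (bounded_meas_integrable bg)) => //.
Qed.

(** If v is positive at x, it is at least v(x) / 2 on a nondegenerate segment
    containing x, and its integral over that segment cannot vanish. *)
Lemma Rintegral0_eq0 a b v : a < b -> {within `[a, b], continuous v} ->
  (forall x, a <= x <= b -> \int[mu]_(s in `[a, x]) v s = 0) ->
  forall x, a <= x <= b -> v x = 0.
Proof.
move=> ab.
suff H v' : {within `[a, b], continuous v'} ->
    (forall x, a <= x <= b -> \int[mu]_(s in `[a, x]) v' s = 0) ->
    forall x, a <= x <= b -> v' x <= 0.
  move=> cv v0 x xab; apply/le_anti; rewrite (H v)//=.
  rewrite -oppr_le0; apply: (H (fun s => - v s)) => //.
    by move=> z; apply: continuousN; exact: cv.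
  move=> z zab; have [M bv] := continuous_bounded_meas cv.
  have /andP[az zb] := zab.
  have bvz : bounded_meas a z M v by exact: bounded_measS bv.
  under eq_Rintegral do rewrite -mulN1r.
  by rewrite RintegralZl ?v0 ?mulr0//; exact: bounded_meas_integrable bvz.
clear v; rename v' into v.
move=> cv v0 x /[dup] xab /andP[ax xb]; rewrite leNgt; apply/negP => vx.
have vx2 : 0 < v x / 2 by rewrite divr_gt0.
have [M bv] := continuous_bounded_meas cv.
have [d d0 Hd] := (within_continuousP _ _ _).1 cv x xab _ vx2.
have d2 : 0 < d / 2 by rewrite divr_gt0.
pose l := Num.max a (x - d / 2); pose r := Num.min b (x + d / 2).
have al : a <= l by rewrite le_max lexx.
have rb : r <= b by rewrite ge_min lexx.
have lr : l < r.
  rewrite gt_max !lt_min ab/=.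
  by apply/andP; split; [lra|apply/andP; split; lra].
have ar : a <= r by exact: le_trans (ltW lr).
have lb : l <= b by exact: le_trans (ltW lr) rb.
have br : bounded_meas a r M v by exact: bounded_measS bv.
have S := Rintegral_split al (ltW lr) (bounded_meas_integrable br).
rewrite !v0 ?al ?ar ?lb ?rb// add0r in S.
have H := @Rintegral_ge_cst l r M (v x / 2) v (ltW lr) (bounded_measS al (lexx _) br).
suff /H : forall s, l <= s <= r -> v x / 2 <= v s.
  by rewrite -S leNgt mulr_gt0 ?subr_gt0.
move=> s /andP[ls sr].
have := Hd s; rewrite (le_trans al ls) (le_trans sr rb) => /(_ isT).
have H1 : x - d / 2 <= s by apply: le_trans ls; rewrite le_max lexx orbT.
have H2 : s <= x + d / 2 by apply: le_trans sr _; rewrite ge_min lexx orbT.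
have : `|s - x| < d by rewrite ltr_norml; apply/andP; split; lra.
move=> + H' => /H'; rewrite ltr_norml => /andP[+ _]; lra.
Qed.

(** With U = J_p h, both w - w(a) and the given multiple of U have the same
    image under J_(1-p).  Applying J_p to their difference v shows that all
    integrals of v from a vanish, so v = 0. *)
Lemma abel_inversion p a b c w h M : 0 < p < 1 -> a < b ->
  {within `[a, b], continuous w} -> bounded_meas a b M h ->
  (forall t, a <= t <= b -> abel (1 - p) (fun s => w s - w a) t a t =
     c * \int[mu]_(s in `[a, t]) h s) ->
  forall t, a <= t <= b ->
    w t = w a + c / abel_beta (1 - p) * abel p h t a t.
Proof.
move=> p01 ab cw bh wh.
have /andP[p0 p1] := p01.
have q0 : 0 < 1 - p by rewrite subr_gt0.
have q1 : 1 - p < 1 by rewrite gtrBl.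
have q01 : 0 < 1 - p < 1 by rewrite q0 q1.
set B := abel_beta (1 - p).
have B0 : B != 0 by rewrite gt_eqF// (lt_le_trans ltr01)// abel_beta_ge1.
pose U t := abel p h t a t.
pose v t := (w t - w a) + - (c / B) * U t.
have cU : {within `[a, b], continuous U} by apply: abel_continuous bh => //; exact: ltW.
have cw' : {within `[a, b], continuous (fun t => w t - w a)}.
  by move=> z; apply: continuousB; [exact: cw|exact: cst_continuous].
have cv : {within `[a, b], continuous v}.
  rewrite /v => z; apply: (continuousD (cw' z)).
  by apply: continuousM; [exact: cst_continuous|exact: cU].
have [MU bU] := continuous_bounded_meas cU.
have [Mw bw] := continuous_bounded_meas cw'.
have [Mv bv] := continuous_bounded_meas cv.
have v0 t : a <= t <= b -> abel (1 - p) v t a t = 0.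
  move=> /[dup] tab /andP[at_ tb].
  have bwt := bounded_measS (lexx a) tb bw.
  have bUt := bounded_measS (lexx a) tb bU.
  rewrite (abelD q0 (lexx t) bwt (bounded_measZ _ bUt)) (abelZ _ q0 (lexx t) bUt) wh//.
  have := abel_comp q01 tb bh; rewrite subKr => ->.
  by rewrite -/B mulrA mulNr divfK// mulNr subrr.
have {}v0 t : a <= t <= b -> \int[mu]_(s in `[a, t]) v s = 0.
  move=> /[dup] tab /andP[at_ tb].
  have := abel_comp p01 tb bv.
  rewrite (@eq_abel _ _ _ (fun=> 0)); last first.
    by move=> s /andP[as_ st]; rewrite v0// as_ (le_trans st tb).
  rewrite abel_cst// mul0r => /esym/eqP; rewrite mulf_eq0 => /orP[|/eqP//].
  by rewrite gt_eqF// (lt_le_trans ltr01)// abel_beta_ge1.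
move=> t tab; have := Rintegral0_eq0 ab cv v0 tab.
by rewrite /v mulNr => /eqP; rewrite subr_eq0 subr_eq => /eqP ->; rewrite addrC.
Qed.

End inversion.

(** * Minimum principle for the Caputo equation *)

Section extremum.
Context {R : realType}.
Local Notation mu := (@lebesgue_measure R).
Implicit Types (f g h w v : R -> R) (p a b c s t x y z M L : R).

(** This and [powRB_ge] are the two bounds that the mean value theorem gives for
    the increment of z |-> z^p, whose derivative is decreasing. *)
Lemma powRB_le p x y : 0 < p -> p <= 1 -> 0 < y -> y <= x ->
  x `^ p - y `^ p <= (x - y) * y `^ (p - 1).
Proof.
move=> p0 p1 y0 yx; have x0 := lt_le_trans y0 yx.
rewrite -(mulr_powRB1 (ltW x0) p0) -(mulr_powRB1 (ltW y0) p0) mulrBl lerD2r.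
rewrite ler_pM2l//.
by have := @ler_kernel R p 0 y x p1 y0 yx; rewrite !subr0.
Qed.

Lemma powRB_ge p x y : 0 < p -> p <= 1 -> 0 <= y -> y <= x ->
  (x - y) * x `^ (p - 1) <= (x `^ p - y `^ p) / p.
Proof.
move=> p0 p1 y0 yx.
have xy0 : 0 <= x - y by rewrite subr_ge0.
have xyx : x - y <= x by rewrite gerBl.
have := @Rintegral_kernel R p x 0 (x - y) p0 xy0 xyx; rewrite subr0 subKr => <-.
have -> : (x - y) * x `^ (p - 1) = \int[mu]_(s in `[0, x - y]) (x `^ (p - 1)).
  rewrite Rintegral_cst//= lebesgue_measure_itv/= lte_fin mulrC.
  by move: xy0; rewrite le_eqVlt => /predU1P[<-|xy0]; [rewrite ltxx|rewrite xy0/= subr0].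
apply: le_Rintegral_co.
- exact: bounded_meas_integrable (bounded_meas_cst _ _ _).
- exact: integrable_kernel.
- move=> s /andP[s0 sxy].
  have := @ler_kernel R p 0 (x - s) x p1; rewrite !subr0; apply; last by rewrite gerBl.
  by rewrite subr_gt0 (lt_le_trans sxy).
Qed.

(** Only the oscillation of h near t1 matters at the scale (t1 - s)^p: the
    contribution of the remote past is linear in t1 - s. *)
Lemma abel_little_o p a t1 M h : 0 < p < 1 -> a < t1 ->
  {within `[a, t1], continuous h} -> bounded_meas a t1 M h ->
  forall k, 0 < k -> exists2 e, 0 < e <= t1 - a &
    forall s, t1 - e <= s <= t1 ->
      abel p h s a s - abel p h t1 a t1 <= k * (t1 - s) `^ p.
Proof.
move=> /andP[p0 p1] at1 ch bh k k0.
have pn0 : p != 0 by rewrite gt_eqF.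
have M0 : 0 <= M by apply: le_trans (bh.2 a _); rewrite ?lexx// ltW.
pose k' := k * p / 4.
have k'0 : 0 < k' by rewrite divr_gt0// mulr_gt0.
have t1t1 : a <= t1 <= t1 by rewrite lexx ltW.
have [d d0 Hd] := (within_continuousP _ _ _).1 ch t1 t1t1 _ k'0.
pose u := Num.max a (t1 - d / 2).
have au : a <= u by rewrite le_max lexx.
have ud : t1 - d / 2 <= u by rewrite le_max lexx orbT.
have ut1 : u < t1 by rewrite gt_max at1/= ltrBlDr ltrDl divr_gt0.
have hu s : u <= s <= t1 -> h t1 - k' <= h s <= h t1 + k'.
  move=> /andP[us st1]; have := Hd s; rewrite (le_trans au us) st1 => /(_ isT).
  have : `|s - t1| < d by rewrite ltr_norml; apply/andP; split; lra.
  by move=> + H => /H; rewrite ltr_norml => /andP[H1 H2]; apply/andP; split; lra.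
pose m := (u + t1) / 2.
have um : u < m by rewrite /m; lra.
have mt : m < t1 by rewrite /m; lra.
pose N := (m - u) `^ (p - 1).
have N0 : 0 <= N by exact: powR_ge0.
have MN : 0 < M * N + 1 by rewrite ltr_wpDl// mulr_ge0.
have q0 : 0 < 1 - p by rewrite subr_gt0.
(* makes M N (t1 - s)^(1 - p) <= k', which absorbs the remote past *)
have [d' d'0 Hd'] := powR_small q0 (divr_gt0 k'0 MN).
exists (Num.min (t1 - m) (d' / 2)).
  rewrite lt_min subr_gt0 mt divr_gt0//= ge_min; apply/orP; left.
  by rewrite lerD2l lerN2 (le_trans au)// ltW.
move=> s /andP[se st1].
have em : Num.min (t1 - m) (d' / 2) <= t1 - m by rewrite ge_min lexx.
have ed : Num.min (t1 - m) (d' / 2) <= d' / 2 by rewrite ge_min lexx orbT.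
have ms : m <= s by lra.
have sd : t1 - s < d' by lra.
have ht1M : `|h t1| <= M by apply: bh.2; rewrite lexx ltW.
have us : u <= s by apply: le_trans ms; exact: ltW.
have := @abel_increment_le R p h a u s t1 M (h t1) k' p0 (ltW p1) au us st1 bh ht1M hu.
move=> /le_trans; apply.
have ts0 : 0 <= t1 - s by rewrite subr_ge0.
have E1 : (t1 - u) `^ p - (s - u) `^ p <= (t1 - s) * N.
  have su0 : 0 < s - u by rewrite subr_gt0 (lt_le_trans um).
  have := @powRB_le p (t1 - u) (s - u) p0 (ltW p1) su0.
  rewrite lerD2r => /(_ st1) /le_trans; apply.
  have -> : t1 - u - (s - u) = t1 - s by ring.
  rewrite ler_wpM2l//; apply: ler_kernel => //; exact: ltW.
have E2 : M * ((t1 - s) * N) <= k' * (t1 - s) `^ p.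
  (* the powers of t1 - s can only be merged when the base is not 0 *)
  have [->|st] := eqVneq s t1.
    by rewrite subrr mul0r mulr0 mulr_ge0// ?powR_ge0// ltW.
  have ts : 0 < t1 - s by rewrite subr_gt0 lt_neqAle st.
  have -> : M * ((t1 - s) * N) = (M * N * (t1 - s) `^ (1 - p)) * (t1 - s) `^ p.
    rewrite -[in RHS]mulrA -powRD; last by rewrite (gt_eqF ts) implybT.
    by rewrite subrK powRr1//; ring.
  rewrite ler_wpM2r ?powR_ge0//.
  have := Hd' (t1 - s); rewrite ts0 sd => /(_ isT).
  rewrite ltr_pdivlMr// mulrC => /ltW; apply: le_trans.
  by rewrite ler_wpM2r ?powR_ge0// lerDl.
have {}E1 := le_trans (ler_wpM2l M0 E1) E2.
rewrite ler_pdivrMr//.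
rewrite [leRHS](_ : _ = 4 * (k' * (t1 - s) `^ p)); last first.
  by rewrite /k'; move: (_ `^ _) => X; field.
rewrite -[2 * k' * _]mulrA -[2 * M * _]mulrA; move: (M * _) (k' * _) E1 => X Y XY.
have -> : 4 * Y = 2 * Y + 2 * Y by ring.
by rewrite lerD2l ler_pM2l.
Qed.

(** The increment of J_(1-p) v towards a zero t1 of v >= 0: the past [a, t1 - e]
    loses weight, and the last segment contributes at most k e because the
    factor (t1 - s)^p compensates the kernel (t1 - s)^(- p). *)
Lemma abel_min_increment p a t1 e k v M : 0 < p < 1 -> 0 < e <= t1 - a -> 0 <= k ->
  bounded_meas a t1 M v -> (forall s, a <= s <= t1 -> 0 <= v s) ->
  (forall s, t1 - e <= s <= t1 -> v s <= k * (t1 - s) `^ p) ->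
  abel (1 - p) v t1 a t1 - abel (1 - p) v (t1 - e) a (t1 - e) <= k * e.
Proof.
move=> /andP[p0 p1] /andP[e0 ea] k0 bv v0 vk.
have q0 : 0 < 1 - p by rewrite subr_gt0.
have q1 : 1 - p <= 1 by rewrite gerBl ltW.
have ae : a <= t1 - e by rewrite lerBrDr addrC -lerBrDr.
have et : t1 - e <= t1 by rewrite gerBl ltW.
rewrite (abel_split q0 ae et (lexx _) bv).
have bve : bounded_meas a (t1 - e) M v by exact: bounded_measS bv.
have H1 : abel (1 - p) v t1 a (t1 - e) <= abel (1 - p) v (t1 - e) a (t1 - e).
  have := @abel_shift_le R (1 - p) (fun s => - v s) a (t1 - e) (t1 - e) t1 M 0 q0 q1 ae
    (lexx _) et (bounded_measN bve).
  rewrite mul0r (abelN q0 (lexx _) bve) (abelN q0 et bve) => H.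
  rewrite -subr_le0 addrC -[X in _ + X]opprK; apply: H => s /andP[as_ se].
  by rewrite oppr_le0 v0// as_ (le_trans se).
have H2 : abel (1 - p) v t1 (t1 - e) t1 <= k * e.
  have -> : k * e = \int[mu]_(s in `[t1 - e, t1]) k.
    rewrite Rintegral_cst//= lebesgue_measure_itv/= lte_fin.
    by rewrite ltrBlDr ltrDl e0/= opprB addrCA subrr addr0.
  rewrite abel.unlock; apply: le_Rintegral_co.
  - exact: integrable_abel (bounded_measS ae (lexx _) bv).
  - exact: bounded_meas_integrable (bounded_meas_cst _ _ _).
  - move=> s /andP[es st].
    have ts : 0 < t1 - s by rewrite subr_gt0.
    have := vk s; rewrite es ltW// => /(_ isT) vs.
    apply: (@le_trans _ _ ((t1 - s) `^ (1 - p - 1) * (k * (t1 - s) `^ p))).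
      by rewrite ler_wpM2l ?powR_ge0.
    rewrite mulrCA -powRD; last by rewrite (gt_eqF ts) implybT.
    have -> : 1 - p - 1 + p = 0 by ring.
    by rewrite powRr0 mulr1.
move: (abel _ _ _ _ _) (abel _ _ _ _ _) (abel _ _ _ _ _) H1 H2 => x y z; lra.
Qed.

(** For c = Gamma(1 - p) the hypothesis is the Caputo equation of order p with
    right-hand side h, integrated once.  Split w - w(a) into the constant
    w(t1) - w(a) <= 0 and the nonnegative function w - w(t1) vanishing at t1.
    Over a short segment [t1 - e, t1], the former contributes
    at most e (w(t1) - w(a)) (t1 - a)^(- p) to the increment of J_(1-p), and the
    latter o(e), while the increment is c times the integral of h. *)
Lemma abel_min_principle p a b c w h t1 : 0 < p < 1 -> 0 < c -> a < b ->
  {within `[a, b], continuous w} -> {within `[a, b], continuous h} ->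
  (forall t, a <= t <= b -> abel (1 - p) (fun s => w s - w a) t a t =
     c * \int[mu]_(s in `[a, t]) h s) ->
  a < t1 <= b -> (forall s, a <= s <= t1 -> w t1 <= w s) ->
  c * h t1 <= (w t1 - w a) * (t1 - a) `^ (- p).
Proof.
move=> p01 c0 ab cw ch wh /andP[at1 t1b] wmin.
have /andP[p0 p1] := p01.
have q0 : 0 < 1 - p by rewrite subr_gt0.
have q1 : 1 - p < 1 by rewrite gtrBl.
have q01 : 0 < 1 - p < 1 by rewrite q0 q1.
have [M bh] := continuous_bounded_meas ch.
have inv := abel_inversion p01 ab cw bh wh.
set B := abel_beta (1 - p) in inv.
have B0 : 0 < B by rewrite (lt_le_trans ltr01)// abel_beta_ge1.
have at1' := ltW at1.
have cB : 0 < c / B by rewrite divr_gt0.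
have sub1 : `[a, t1]%classic `<=` `[a, b]%classic by exact: segment_subset.
have ch1 : {within `[a, t1], continuous h} := continuous_subspaceW sub1 ch.
have bh1 := bounded_measS (lexx a) t1b bh.
have cv : {within `[a, t1], continuous (fun s => w s - w t1)}.
  by move=> z; apply: continuousB; [exact: (continuous_subspaceW sub1 cw)|exact: cst_continuous].
have [Mv bv] := continuous_bounded_meas cv.
have v0 s : a <= s <= t1 -> 0 <= w s - w t1 by move=> /wmin; rewrite subr_ge0.
rewrite leNgt; apply/negP => lt.
pose A := (w t1 - w a) * (t1 - a) `^ (- p).
have A0 : w t1 - w a <= 0 by rewrite subr_le0 wmin// lexx ltW.
(* the errors committed below add up to (c + 1) k, half of the gap *)
pose k := (c * h t1 - A) / (2 * (c + 1)).
have c1 : 0 < c + 1 by rewrite addr_gt0.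
have k0 : 0 < k by rewrite divr_gt0 ?subr_gt0// mulr_gt0.
have kB : 0 < k / (c / B) by rewrite divr_gt0.
have [e1 /andP[e10 e1a] He1] := abel_little_o p01 at1 ch1 bh1 kB.
have t1t1 : a <= t1 <= t1 by rewrite lexx ltW.
have [d d0 Hd] := (within_continuousP _ _ _).1 ch1 t1 t1t1 _ k0.
pose e := Num.min e1 (d / 2).
have e0 : 0 < e by rewrite lt_min e10 divr_gt0.
have ee1 : e <= e1 by rewrite ge_min lexx.
have ed : e <= d / 2 by rewrite ge_min lexx orbT.
have ea : e <= t1 - a by exact: le_trans e1a.
have ae : a <= t1 - e by rewrite lerBrDr addrC -lerBrDr.
have et : t1 - e <= t1 by rewrite gerBl ltW.
have He s : t1 - e <= s <= t1 -> w s - w t1 <= k * (t1 - s) `^ p.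
  move=> /andP[es st].
  have /He1 H : t1 - e1 <= s <= t1 by rewrite st (le_trans _ es)// lerD2l lerN2.
  have as_ : a <= s by exact: le_trans es.
  rewrite (inv s) ?as_ ?(le_trans st t1b)// (inv t1) ?t1b ?at1'//.
  rewrite opprD addrACA subrr add0r -mulrBr.
  by move: H; rewrite mulrAC ler_pdivlMr// mulrC.
have V := abel_min_increment p01 (introT andP (conj e0 ea)) (ltW k0) bv v0 He.
have dec t : a <= t <= t1 -> abel (1 - p) (fun s => w s - w a) t a t =
    abel (1 - p) (fun s => w s - w t1) t a t + (w t1 - w a) * ((t - a) `^ (1 - p) / (1 - p)).
  move=> /andP[at_ tt1].
  have E : (t - a) `^ (1 - p) / (1 - p) = ((t - a) `^ (1 - p) - (t - t) `^ (1 - p)) / (1 - p).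
    by rewrite subrr powR0 ?gt_eqF// subr0.
  rewrite E -abel_cst// -(abelD q0 (lexx _) (bounded_measS (lexx _) tt1 bv) (bounded_meas_cst _ _ _)).
  by apply: eq_abel => s _; ring.
have I : c * \int[mu]_(s in `[t1 - e, t1]) h s =
  abel (1 - p) (fun s => w s - w a) t1 a t1 - abel (1 - p) (fun s => w s - w a) (t1 - e) a (t1 - e).
  rewrite !wh ?ae ?(le_trans et t1b) ?t1b ?at1'//.
  rewrite (Rintegral_split ae et (bounded_meas_integrable bh1)).
  by move: (Rintegral _ _ _) (Rintegral _ _ _) => x y; ring.
have J : (h t1 - k) * e <= \int[mu]_(s in `[t1 - e, t1]) h s.
  have := @Rintegral_ge_cst R (t1 - e) t1 M (h t1 - k) h et (bounded_measS ae (lexx _) bh1).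
  rewrite subKr; apply=> s /andP[es st].
  have := Hd s; rewrite st (le_trans ae es) => /(_ isT).
  have : `|s - t1| < d by rewrite ltr_norml; apply/andP; split; lra.
  by move=> + H => /H; rewrite ltr_norml => /andP[H1 H2]; lra.
rewrite (dec t1)// (dec (t1 - e)) ?ae ?et// in I.
have te0 : 0 <= t1 - e - a by rewrite subr_ge0.
have tea : t1 - e - a <= t1 - a by rewrite lerD2r.
have := powRB_ge q0 (ltW q1) te0 tea.
have -> : t1 - a - (t1 - e - a) = e by ring.
have -> : 1 - p - 1 = - p by ring.
move=> P.
have {}P := ler_wnM2l A0 P.
have {}J := ler_wpM2l (ltW c0) J.
rewrite {}I in J.
have K : (c * (h t1 - k)) * e <= (k + A) * e.
  rewrite -[leLHS]mulrA; apply: le_trans J _; rewrite [leRHS]mulrDl /A.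
  move: P V; move: (abel _ _ _ _ _) (abel _ _ _ _ _) (_ `^ (1 - p)) (_ `^ (1 - p)) (_ `^ (- p)).
  move=> y x Y X Z P V.
  have E : x + (w t1 - w a) * (X / (1 - p)) - (y + (w t1 - w a) * (Y / (1 - p))) =
    (x - y) + (w t1 - w a) * ((X - Y) / (1 - p)).
    by field; rewrite gt_eqF.
  rewrite {}E -[(w t1 - w a) * Z * e]mulrA [Z * e]mulrC.
  exact: lerD.
rewrite ler_pM2r// in K.
have : k * (2 * (c + 1)) = c * h t1 - A by rewrite divfK// gt_eqF// mulr_gt0.
move: K; move: (h t1) => H; rewrite mulrBr => K E.
nra.
Qed.

End extremum.

(** * Stability estimates for the difference of two solutions *)

Section stability.
Context {R : realType}.
Local Notation mu := (@lebesgue_measure R).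
Implicit Types (f g h w v : R -> R) (p a b c s t x y z m M L : R).

(** The point is the infimum of the times at which w is at most m. *)
Lemma first_time_le a b m w : a <= b -> {within `[a, b], continuous w} ->
  m < w a -> w b <= m ->
  exists2 t, a < t <= b & w t = m /\ forall s, a <= s <= t -> m <= w s.
Proof.
move=> ab cw wa wb.
pose S : set R := [set t | a <= t <= b /\ w t <= m].
have Sb : S b by split; rewrite ?ab ?lexx.
have Sa : lbound S a by move=> t [/andP[]].
have hS : has_inf S by split; [exists b|exists a].
pose t := inf S.
have at_ : a <= t by apply: lb_le_inf => //; exists b.
have tb : t <= b by apply: ge_inf => //; exists a.
have cwP := (within_continuousP _ _ _).1 cw.
have tab : a <= t <= b by rewrite at_.
have wt : w t <= m.
  rewrite leNgt; apply/negP => mt.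
  have mt0 : 0 < w t - m by rewrite subr_gt0.
  have [d d0 Hd] := cwP t tab _ mt0.
  have [s [sab ws] sd] := inf_adherent d0 hS.
  have ts : t <= s by apply: ge_inf; [exists a|].
  have := Hd s sab; rewrite ger0_norm ?subr_ge0// ltrBlDl => /(_ sd).
  by rewrite ltr_norml => /andP[+ _]; lra.
have before s : a <= s < t -> m < w s.
  move=> /andP[as_ st]; rewrite ltNge; apply/negP => ws.
  have : t <= s by apply: ge_inf; [exists a|split => //; rewrite as_ (ltW (lt_le_trans st tb))].
  by rewrite leNgt st.
have at' : a < t.
  rewrite lt_neqAle at_ andbT; apply/eqP => E.
  by move: wt; rewrite -E leNgt wa.
have tm : m <= w t.
  rewrite leNgt; apply/negP => mt.
  have mt0 : 0 < m - w t by rewrite subr_gt0.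
  have [d d0 Hd] := cwP t tab _ mt0.
  pose s := Num.max a (t - d / 2).
  have as_ : a <= s by rewrite le_max lexx.
  have ds : t - d / 2 <= s by rewrite le_max lexx orbT.
  have st : s < t by rewrite gt_max at'/= ltrBlDr ltrDl divr_gt0.
  have ms : m < w s by apply: before; rewrite as_.
  have sab : a <= s <= b by rewrite as_ (ltW (lt_le_trans st tb)).
  have sd : `|s - t| < d by rewrite ltr_norml; apply/andP; split; lra.
  by have := Hd s sab sd; rewrite ltr_norml => /andP[_]; lra.
exists t; first by rewrite at'.
split; first by apply/le_anti; rewrite wt.
move=> s /andP[as_]; rewrite le_eqVlt => /predU1P[->//|st].
by apply: ltW; apply: before; rewrite as_.
Qed.

(** With D = 1 + c L (b - a)^p, the function w stays above m = w(a) / (2 D):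
    at the first time t where it is equal to m, the minimum principle and
    |h(t)| <= L m would give w(a) <= D m. *)
Lemma abel_lower_bound_pos p a b c L w h : 0 < p < 1 -> 0 < c -> 0 <= L -> a < b ->
  {within `[a, b], continuous w} -> {within `[a, b], continuous h} ->
  (forall t, a <= t <= b -> abel (1 - p) (fun s => w s - w a) t a t =
     c * \int[mu]_(s in `[a, t]) h s) ->
  (forall t, a <= t <= b -> `|h t| <= L * `|w t|) ->
  0 < w a -> w a <= 2 * (1 + c * L * (b - a) `^ p) * w b.
Proof.
move=> p01 c0 L0 ab cw ch wh hL wa0.
have /andP[p0 p1] := p01.
pose D := 1 + c * L * (b - a) `^ p.
have cL0 : 0 <= c * L by rewrite mulr_ge0// ltW.
have D0 : 0 < D by rewrite ltr_wpDr// mulr_ge0 ?powR_ge0.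
have D20 : 0 < 2 * D by rewrite mulr_gt0.
rewrite -/D mulrC -ler_pdivrMr//; rewrite leNgt; apply/negP => wb.
set m := w a / (2 * D) in wb.
have m0 : 0 < m by rewrite divr_gt0.
have mD : m * (2 * D) = w a by rewrite divfK// gt_eqF.
have D1 : 1 <= D by rewrite lerDl mulr_ge0 ?powR_ge0.
have mwa : m < w a by rewrite -mD ltr_pMr//; lra.
have [t /andP[at_ tb] [wt wmin]] := first_time_le (ltW ab) cw mwa (ltW wb).
have wmin' s : a <= s <= t -> w t <= w s by rewrite wt; exact: wmin.
have tab : a < t <= b by rewrite at_.
have := abel_min_principle p01 c0 ab cw ch wh tab wmin'.
have := hL t; rewrite tb (ltW at_) wt (gtr0_norm m0) => /(_ isT).
rewrite ler_norml => /andP[hl _].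
have T0 : 0 < t - a by rewrite subr_gt0.
have TP0 : 0 < (t - a) `^ p by rewrite powR_gt0.
rewrite powRN ler_pdivlMr// => H.
have TP : (t - a) `^ p <= (b - a) `^ p.
  by apply: ge0_ler_powR; rewrite ?nnegrE ?subr_ge0 ?lerD2r// ltW.
have H2 : - (L * m) * c * (t - a) `^ p <= m - w a.
  apply: le_trans H; rewrite ler_wpM2r ?(ltW TP0)// [leRHS]mulrC.
  by rewrite ler_wpM2r// ltW.
have H3 : c * L * (t - a) `^ p <= c * L * (b - a) `^ p by rewrite ler_wpM2l.
have H4 : m * (c * L * (t - a) `^ p) <= m * (c * L * (b - a) `^ p) by rewrite ler_pM2l.
have : w a <= m * D.
  rewrite /D mulrDr mulr1 -lerBlDl; apply: le_trans H4.
  by rewrite -lerN2 opprB; apply: le_trans H2; rewrite le_eqVlt; apply/orP; left; apply/eqP; ring.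
have : 0 < m * D by rewrite mulr_gt0.
by rewrite -mD mulrCA; move: (m * D) => x x0; lra.
Qed.

Lemma abel_lower_bound p a b c L w h : 0 < p < 1 -> 0 < c -> 0 <= L -> a < b ->
  {within `[a, b], continuous w} -> {within `[a, b], continuous h} ->
  (forall t, a <= t <= b -> abel (1 - p) (fun s => w s - w a) t a t =
     c * \int[mu]_(s in `[a, t]) h s) ->
  (forall t, a <= t <= b -> `|h t| <= L * `|w t|) ->
  `|w a| <= 2 * (1 + c * L * (b - a) `^ p) * `|w b|.
Proof.
move=> p01 c0 L0 ab cw ch wh hL.
have /andP[p0 p1] := p01.
have q0 : 0 < 1 - p by rewrite subr_gt0.
have D0 : 0 <= 2 * (1 + c * L * (b - a) `^ p).
  by rewrite mulr_ge0// addr_ge0// !mulr_ge0 ?powR_ge0// ltW.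
have [wa|wa|->] := ltgtP (w a) 0; last by rewrite normr0 mulr_ge0.
- rewrite -[`|w b|]normrN -[`|w a|]normrN [`|- w a|]gtr0_norm ?oppr_gt0//.
  apply: le_trans (ler_wpM2l D0 (ler_norm _)).
  apply: (@abel_lower_bound_pos _ _ _ _ _ (fun s => - w s) (fun s => - h s) p01) => //.
  + by move=> z; apply: continuousN; exact: cw.
  + by move=> z; apply: continuousN; exact: ch.
  + move=> t /[dup] tab /andP[at_ tb].
    have [M bh] := continuous_bounded_meas ch.
    have cw' : {within `[a, b], continuous (fun t => w t - w a)}.
      by move=> z; apply: continuousB; [exact: cw|exact: cst_continuous].
    have [Mw bw] := continuous_bounded_meas cw'.
    rewrite (@eq_abel _ _ _ (fun s => - (w s - w a))); last by move=> s _; rewrite opprB opprK addrC.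
    rewrite (abelN q0 (lexx t) (bounded_measS (lexx a) tb bw)) wh//.
    under [in RHS]eq_Rintegral do rewrite -mulN1r.
    rewrite RintegralZl ?mulN1r ?mulrN//.
    exact: bounded_meas_integrable (bounded_measS (lexx a) tb bh).
  + by move=> t tab; rewrite !normrN hL.
  + by rewrite oppr_gt0.
- rewrite [`|w a|]gtr0_norm//.
  apply: le_trans (ler_wpM2l D0 (ler_norm _)).
  exact: (@abel_lower_bound_pos _ _ _ _ _ w h p01).
Qed.

(** Let N be the maximum of |w(t)| exp(- nu (t - a)), attained at t0.  In the
    Abel integral at t0, the segment of length tau before t0 carries little of
    the kernel, and on the earlier part the exponential weight is smaller by the
    factor exp(- nu tau).  For tau small and then nu large the integral
    term is at most half of |w(t0)|. *)
Lemma abel_gronwall p a b k : 0 < p -> a <= b -> 0 <= k ->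
  exists2 K, 0 <= K & forall w W, {within `[a, b], continuous w} ->
    (forall t, a <= t <= b -> `|w t| <= W + k * abel p (fun s => `|w s|) t a t) ->
    forall t, a <= t <= b -> `|w t| <= K * W.
Proof.
move=> p0 ab k0.
have k1 : 0 < 4 * (k + 1) by rewrite mulr_gt0// ltr_wpDl.
have [d d0 Hd] := powR_small p0 (divr_gt0 p0 k1).
pose tau := d / 2.
have tau0 : 0 < tau by rewrite divr_gt0.
have tauP : k * (tau `^ p / p) <= 4^-1.
  have := Hd tau; rewrite ltW//= ltr_pdivrMr// ltr_pMr// ltr1n => /(_ isT)/ltW.
  rewrite ler_pdivlMr// => H.
  have P0 := powR_ge0 tau p.
  rewrite mulrA ler_pdivrMr//.
  by move: (_ `^ _) P0 H => X P0 H; nra.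
pose Q := (b - a) `^ p / p.
have Q0 : 0 <= Q by rewrite divr_ge0 ?powR_ge0//; exact: ltW.
(* exp(- nu tau) <= 1 / (1 + nu tau) makes the early part at most 1/4 *)
pose nu := 4 * k * Q / tau.
have nu0 : 0 <= nu.
  by apply: divr_ge0; [apply: mulr_ge0 => //; exact: mulr_ge0|exact: ltW].
have nuP : k * (expR (- (nu * tau)) * Q) <= 4^-1.
  have := expR_ge1Dx (nu * tau); rewrite divfK ?gt_eqF// => H.
  rewrite expRN mulrCA -ler_pdivlMl ?invr_gt0 ?expR_gt0// invrK.
  by rewrite ler_pdivlMr//; lra.
exists (2 * expR (nu * (b - a))); first by rewrite mulr_ge0 ?expR_ge0.
move=> w W cw wW.
have cn : {within `[a, b], continuous (fun s => `|w s|)}.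
  by move=> x; apply: continuous_comp; [exact: cw|exact: norm_continuous].
have [M bw] := continuous_bounded_meas cn.
pose E t := expR (nu * (t - a)).
have E0 t : 0 < E t by exact: expR_gt0.
have cg : {within `[a, b], continuous (fun s => `|w s| / E s)}.
  have cE : {within `[a, b], continuous (fun s => (E s)^-1)}.
    apply: continuous_subspaceT => y; apply: cvgV; first by rewrite gt_eqF.
    have c1 : (fun s => nu * (s - a)) @ y --> nu * (y - a).
      by apply: cvgM; [exact: cvg_cst|apply: cvgB; [exact: cvg_id|exact: cvg_cst]].
    apply: (@continuous_comp _ _ _ (fun s => nu * (s - a)) expR y c1).
    exact: continuous_expR.
  by move=> x; apply: (continuousM (cn x) (cE x)).
have [t0 t0ab Ht0] := EVT_max ab cg.
rewrite in_itv/= in t0ab.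
pose N := `|w t0| / E t0.
have N0 : 0 <= N by rewrite divr_ge0// ltW.
have wN s : a <= s <= b -> `|w s| <= N * E s.
  by move=> sab; rewrite -ler_pdivrMr//; apply: Ht0; rewrite in_itv.
have Emono s t : s <= t -> E s <= E t.
  by move=> st; rewrite ler_expR ler_wpM2l// lerD2r.
have /andP[at0 t0b] := t0ab.
pose r := Num.max a (t0 - tau).
have ar : a <= r by rewrite le_max lexx.
have rt : t0 - tau <= r by rewrite le_max lexx orbT.
have rt0 : r <= t0 by rewrite ge_max at0/= gerBl ltW.
have bwt := bounded_measS (lexx a) t0b bw.
have bw1 := bounded_measS (lexx a) rt0 bwt.
have bw2 := bounded_measS ar (lexx t0) bwt.
have mono x y : 0 <= x -> x <= y -> x `^ p <= y `^ p.
  by move=> x0 xy; apply: ge0_ler_powR; rewrite ?nnegrE ?(le_trans x0 xy)// ltW.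
have A2 : k * abel p (fun s => `|w s|) t0 r t0 <= N * E t0 * 4^-1.
  have := @abel_le _ p _ t0 r t0 M (N * E t0) p0 rt0 (lexx _) bw2.
  have H s : r <= s <= t0 -> `|w s| <= N * E t0.
    move=> /andP[rs st]; apply: (le_trans (wN s _)).
      by rewrite (le_trans ar rs) (le_trans st t0b).
    by rewrite ler_wpM2l// Emono.
  move=> /(_ H); have -> : (t0 - t0) `^ p = 0 by rewrite subrr powR0// gt_eqF.
  rewrite subr0 => {}H; apply: le_trans (ler_wpM2l k0 H) _.
  rewrite mulrCA; apply: ler_wpM2l; first by rewrite mulr_ge0// ltW.
  apply: le_trans tauP; rewrite ler_wpM2l// ler_pM2r ?invr_gt0//.
  apply: mono; first by rewrite subr_ge0.
  by rewrite lerBlDl -lerBlDr.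
have A1 : k * abel p (fun s => `|w s|) t0 a r <= N * E t0 * 4^-1.
  have := @abel_le _ p _ t0 a r M (N * E r) p0 ar rt0 bw1.
  have H s : a <= s <= r -> `|w s| <= N * E r.
    move=> /andP[as_ sr]; apply: (le_trans (wN s _)).
      by rewrite as_ (le_trans sr (le_trans rt0 t0b)).
    by rewrite ler_wpM2l// Emono.
  move=> /(_ H) {}H; apply: le_trans (ler_wpM2l k0 H) _.
  have NE : 0 <= N * E t0 by rewrite mulr_ge0// ltW.
  have NE4 : 0 <= N * E t0 * 4^-1 by rewrite mulr_ge0.
  have [ta|at_] := leP (t0 - tau) a.
    have -> : r = a by rewrite /r; apply/max_idPl.
    by rewrite subrr mul0r !mulr0.
  have rE : r = t0 - tau by rewrite /r; apply/max_idPr/ltW.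
  have -> : E r = E t0 * expR (- (nu * tau)).
    by rewrite /E rE -expRD; congr expR; ring.
  have X : ((t0 - a) `^ p - (t0 - r) `^ p) / p <= Q.
    rewrite ler_pM2r ?invr_gt0//; apply: (@le_trans _ _ ((t0 - a) `^ p)).
      by rewrite gerBl powR_ge0.
    by apply: mono; rewrite ?subr_ge0// lerD2r.
  have {}X := ler_wpM2l (expR_ge0 (- (nu * tau))) X.
  have {}X := le_trans (ler_wpM2l k0 X) nuP.
  move: X; move: (_ / p) (expR _) => D e X.
  rewrite (_ : k * (N * (E t0 * e) * D) = N * E t0 * (k * (e * D))); last by ring.
  by rewrite ler_wpM2l// mulr_ge0// ltW.
have at0b := wW t0 t0ab.
rewrite (abel_split p0 ar rt0 (lexx _) bwt) mulrDr in at0b.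
have NW : N * E t0 <= 2 * W.
  have E1 : N * E t0 = `|w t0| by rewrite divfK// gt_eqF.
  rewrite -E1 in at0b.
  move: (k * _) (k * _) A1 A2 at0b; move: (N * E t0) => n x y; lra.
have W0 : 0 <= W.
  have : 0 <= 2 * W by apply: le_trans NW; rewrite mulr_ge0// ltW.
  by rewrite pmulr_rge0.
have N2 : N <= 2 * W.
  apply: le_trans NW; rewrite ler_peMr// -expR0 ler_expR mulr_ge0// subr_ge0//.
move=> t tab; apply: le_trans (wN t tab) _.
rewrite [leRHS]mulrAC; apply: ler_pM => //; first exact: ltW.
by apply: Emono; case/andP: tab.
Qed.

End stability.

(** * From the Caputo derivative to the integrated equation *)

Section caputo.
Context {R : realType}.
Local Notation mu := (@lebesgue_measure R).
Implicit Types (g h w y : R -> R) (f : R -> R -> R) (p a b c s t x M L l : R).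

Lemma within_continuous_comp2 a b c f y : b <= c ->
  {within `[a, c] `*` [set: R], continuous (fun z : R * R => f z.1 z.2)} ->
  {within `[a, b], continuous y} -> {within `[a, b], continuous (fun t => f t (y t))}.
Proof.
move=> bc /subspace_continuousP cf /subspace_continuousP cy.
apply/subspace_continuousP => x xab.
have xac : (`[a, c] `*` [set: R])%classic (x, y x).
  by split => //; exact: segment_subset xab.
have := cf _ xac; apply: cvg_trans.
apply: (@cvg_comp _ _ _ (fun t => (t, y t)) (fun z : R * R => f z.1 z.2)
  _ (within (`[a, c] `*` [set: R]) (nbhs (x, y x)))); last exact: cvg_id.
move=> U; rewrite /within/= => HU.
have H : (fun t => (t, y t)) @ within `[a, b] (nbhs x) --> (x, y x).
  exact: (@cvg_pair _ _ _ (within `[a, b] (nbhs x)) (nbhs x) (nbhs (y x)) _ _ _ (fun t => t) y (cvg_within _) (cy x xab)).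
have {}H : nbhs x [set t | `[a, b]%classic t ->
    (`[a, c] `*` [set: R])%classic (t, y t) -> U (t, y t)] := H _ HU.
change (nbhs x [set t | `[a, b]%classic t -> U (t, y t)]).
apply: filterS H => t Ht tab; apply: Ht => //.
by split => //; exact: segment_subset tab.
Qed.

Lemma is_derive_within_interior a b (F : R -> R) x l : a < x < b ->
  is_derive_within `[a, b] F x l -> derivable F x 1 /\ F^`()%classic x = l.
Proof.
move=> /andP[ax xb] H.
have D : (fun h : R => h^-1 *: (F (h *: 1 + x) - F x)) @ 0^' --> l.
  apply/cvgrPdist_lt => e e0.
  have /cvgrPdist_lt /(_ _ e0) := H.
  rewrite !near_withinE => -[d /= d0 Hd].
  have d'0 : 0 < Num.min d (Num.min (x - a) (b - x)).
    by rewrite !lt_min d0 !subr_gt0 ax xb.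
  near=> h; move=> h0.
  have : `|h| < Num.min d (Num.min (x - a) (b - x)).
    near: h; exists (Num.min d (Num.min (x - a) (b - x))) => //= z /=.
    by rewrite sub0r normrN.
  rewrite !lt_min => /and3P[hd hl hr].
  have /andP[hl1 hl2] : - (x - a) < h < x - a by rewrite -ltr_norml.
  have /andP[hr1 hr2] : - (b - x) < h < b - x by rewrite -ltr_norml.
  have := Hd (h + x).
  rewrite /= addrK opprD addrCA subrr addr0 normrN => /(_ hd) Hx.
  rewrite /GRing.scale/= mulr1 mulrC.
  apply: Hx; first by rewrite -subr_eq0 addrK.
  by rewrite in_itv/=; apply/andP; split; lra.
split; first by apply/cvg_ex; exists l.
by rewrite derive1E; apply: cvg_lim.
Unshelve. all: by end_near. Qed.

Lemma caputo_primitiveE p a y t :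
  caputo_primitive p a y t = (Gamma (1 - p))^-1 * abel (1 - p) (fun s => y s - y a) t a t.
Proof.
rewrite /caputo_primitive abel.unlock; congr (_ * _).
by have -> : 1 - p - 1 = - p by ring.
Qed.

(** The primitive in the definition of the Caputo derivative is continuous on
    [a, b] and vanishes at a, and its derivative in the interior is the
    continuous function g, so it is the integral of g. *)
Lemma caputo_integrated p a b g y : 0 < p < 1 -> a < b ->
  {within `[a, b], continuous y} -> {within `[a, b], continuous g} ->
  (forall t, t \in `]a, b] -> is_caputo_derive p a b y t (g t)) ->
  forall t, a <= t <= b -> abel (1 - p) (fun s => y s - y a) t a t =
    Gamma (1 - p) * \int[mu]_(s in `[a, t]) g s.
Proof.
move=> /andP[p0 p1] ab cy cg Hy t /andP[at_ tb].
have q0 : 0 < 1 - p by rewrite subr_gt0.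
have q1 : 1 - p < 1 by rewrite gtrBl.
have q01 : 0 < 1 - p < 1 by rewrite q0 q1.
have G0 : Gamma (1 - p) != 0 by rewrite gt_eqF// Gamma_gt0.
move: at_; rewrite le_eqVlt => /predU1P[<-|at_].
  by rewrite abel.unlock set_itv1 !Rintegral_set1 mulr0.
have cy' : {within `[a, b], continuous (fun t => y t - y a)}.
  by move=> z; apply: continuousB; [exact: cy|exact: cst_continuous].
have [M bM] := continuous_bounded_meas cy'.
pose P := caputo_primitive p a y.
have PE x : P x = (Gamma (1 - p))^-1 * abel (1 - p) (fun s => y s - y a) x a x.
  exact: caputo_primitiveE.
have sub : `[a, t]%classic `<=` `[a, b]%classic by exact: segment_subset.
have cP : {within `[a, t], continuous P}.
  have -> : P = fun x => (Gamma (1 - p))^-1 * abel (1 - p) (fun s => y s - y a) x a x.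
    exact/funext.
  have cA := abel_continuous q0 (ltW q1) (bounded_measS (lexx a) tb bM).
  by move=> z; apply: (continuousM _ (cA z)); exact: cst_continuous.
have dP x : x \in `]a, t[ -> derivable P x 1 /\ P^`()%classic x = g x.
  rewrite in_itv/= => /andP[ax xt].
  have xab : a < x < b by rewrite ax (lt_le_trans xt tb).
  apply: (is_derive_within_interior xab); apply: Hy.
  by rewrite in_itv/= ax ltW// (lt_le_trans xt tb).
have [_ Pa Pt] := (continuous_within_itvP P at_).1 cP.
have := continuous_FTC2 at_ (continuous_subspaceW sub cg) (And3 (fun x xat => (dP x xat).1) Pa Pt)
  (fun x xat => (dP x xat).2).
have Pa0 : P a = 0.
  by rewrite PE abel.unlock set_itv1 Rintegral_set1 mulr0.
rewrite Pa0 sube0 /Rintegral => -> /=.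
by rewrite PE mulrA divff// mul1r.
Qed.

Lemma abel_norm_le p a t h w M N L : 0 < p ->
  bounded_meas a t M h -> bounded_meas a t N w ->
  (forall s, a <= s <= t -> `|h s| <= L * w s) ->
  `|abel p h t a t| <= L * abel p w t a t.
Proof.
move=> p0 bh bw hw.
rewrite -(abelZ L p0 (lexx t) bw) ler_norml; apply/andP; split.
  rewrite lerNl -(abelN p0 (lexx t) bh).
  apply: (le_abel p0 (lexx t) (bounded_measN bh) (bounded_measZ L bw)) => s /hw.
  by apply: le_trans; rewrite -normrN ler_norm.
apply: (le_abel p0 (lexx t) bh (bounded_measZ L bw)) => s /hw.
by apply: le_trans; rewrite ler_norm.
Qed.

End caputo.

(** * Dependence on the terminal point *)

Theorem theorem3p1 (R : realType) (alpha a T Tsharp ystar : R)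
    (f : R -> R -> R)
    (alpha_gt0 : 0 < alpha) (alpha_lt1 : alpha < 1)
    (aT : a < T) (TTsharp : T <= Tsharp)
    (f_cont : {within `[a, Tsharp] `*` [set: R],
                continuous (fun p : R * R => f p.1 p.2)})
    (f_bounded : exists M : R, forall t u : R,
        t \in `[a, Tsharp] -> `|f t u| <= M)
    (f_lipschitz : exists L : R, 0 <= L /\ forall t u v : R,
        t \in `[a, Tsharp] -> `|f t u - f t v| <= L * `|u - v|) :
  exists C : R, forall y : R -> R, tvp_solution alpha a T f ystar y ->
    forall (T' : R) (y' : R -> R), T' \in `[T, Tsharp] ->
      tvp_solution alpha a T' f ystar y' ->
      (ereal_sup [set (`|y t - y' t|)%:E | t in `[a, T]]
        <= (C * `|T - T'| `^ alpha)%:E)%E.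
Proof.
have [M fM] := f_bounded; have [L [L0 fL]] := f_lipschitz.
have p01 : 0 < alpha < 1 by rewrite alpha_gt0.
have q01 : 0 < 1 - alpha < 1 by rewrite subr_gt0 alpha_lt1 gtrBl.
set c := Gamma (1 - alpha); set B := abel_beta (1 - alpha).
have c0 : 0 < c by exact: Gamma_gt0.
have B0 : 0 < B by rewrite (lt_le_trans ltr01)// abel_beta_ge1.
have cB0 : 0 < c / B by rewrite divr_gt0.
have k0 : 0 <= c / B * L by rewrite mulr_ge0// ltW.
have [K K0 HK] := abel_gronwall alpha_gt0 (ltW aT) k0.
pose D := 2 * (1 + c * L * (T - a) `^ alpha).
have D0 : 0 <= D.
  by rewrite mulr_ge0// addr_ge0// !mulr_ge0 ?powR_ge0// ltW.
exists (K * (D * (c / B * (4 * M / alpha)))) => y [cy Hy yT] T' y'.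
rewrite in_itv/= => /andP[TT' T'T] [cy' Hy' yT'].
have aT' : a < T' by exact: lt_le_trans TT'.
have cg := within_continuous_comp2 TTsharp f_cont cy.
have cg' := within_continuous_comp2 T'T f_cont cy'.
have bg : bounded_meas a T M (fun t => f t (y t)).
  split; first exact: subspace_continuous_measurable_fun.
  by move=> s /andP[as_ sT]; apply: fM; rewrite in_itv/= as_ (le_trans sT).
have bg' : bounded_meas a T' M (fun t => f t (y' t)).
  split; first exact: subspace_continuous_measurable_fun.
  by move=> s /andP[as_ sT]; apply: fM; rewrite in_itv/= as_ (le_trans sT).
have bg'T := bounded_measS (lexx a) TT' bg'.
have sub : `[a, T]%classic `<=` `[a, T']%classic by exact: segment_subset.
have cy'T := continuous_subspaceW sub cy'.
have cg'T := continuous_subspaceW sub cg'.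
have Iy := caputo_integrated p01 aT cy cg Hy.
have Iy' := caputo_integrated p01 aT' cy' cg' Hy'.
have Ey' := abel_inversion p01 aT' cy' bg' Iy'.
pose w t := y t - y' t; pose h t := f t (y t) - f t (y' t).
have cw : {within `[a, T], continuous w}.
  by rewrite /w => z; apply: (continuousB (cy z) (cy'T z)).
have ch : {within `[a, T], continuous h}.
  by rewrite /h => z; apply: (continuousB (cg z) (cg'T z)).
have hL t : a <= t <= T -> `|h t| <= L * `|w t|.
  by move=> /andP[at_ tT]; apply: fL; rewrite in_itv/= at_ (le_trans tT).
have bh : bounded_meas a T (M + M) h := bounded_measD bg (bounded_measN bg'T).
have Iw t : a <= t <= T -> abel (1 - alpha) (fun s => w s - w a) t a t =
    c * Rintegral lebesgue_measure `[a, t] h.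
  move=> /[dup] taT /andP[at_ tT].
  have q0 : 0 < 1 - alpha by case/andP: q01.
  have c1 : {within `[a, T], continuous (fun s => y s - y a)}.
    by move=> z; apply: continuousB; [exact: cy|exact: cst_continuous].
  have c2 : {within `[a, T], continuous (fun s => y' s - y' a)}.
    by move=> z; apply: continuousB; [exact: cy'T|exact: cst_continuous].
  have [M1 b1] := continuous_bounded_meas c1.
  have [M2 b2] := continuous_bounded_meas c2.
  have {}b1 := bounded_measS (lexx a) tT b1.
  have {}b2 := bounded_measS (lexx a) tT b2.
  rewrite (@eq_abel _ _ _ (fun s => (y s - y a) + - (y' s - y' a))); last first.
    by move=> s _; rewrite /w; ring.
  rewrite (abelD q0 (lexx t) b1 (bounded_measN b2)) (abelN q0 (lexx t) b2).
  rewrite Iy// Iy' ?at_ ?(le_trans tT)// -mulrBr -RintegralB//.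
    exact: bounded_meas_integrable (bounded_measS (lexx a) tT bg).
  exact: bounded_meas_integrable (bounded_measS (lexx a) tT bg'T).
have Ew := abel_inversion p01 aT cw bh Iw.
have lower := abel_lower_bound p01 c0 L0 aT cw ch Iw hL.
have cnw : {within `[a, T], continuous (fun s => `|w s|)}.
  by move=> x; apply: continuous_comp; [exact: cw|exact: norm_continuous].
have [N bnw] := continuous_bounded_meas cnw.
have upper := HK w `|w a| cw.
have {}upper t : a <= t <= T -> `|w t| <= K * `|w a|.
  apply: upper => s /[dup] saT /andP[as_ sT].
  rewrite Ew// (le_trans (ler_normD _ _))// lerD2l normrM gtr0_norm//.
  rewrite -[leRHS]mulrA ler_wpM2l ?(ltW cB0)//.
  apply: (abel_norm_le alpha_gt0 (bounded_measS (lexx a) sT bh) (bounded_measS (lexx a) sT bnw)).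
  by move=> r /andP[ar rs]; apply: hL; rewrite ar (le_trans rs sT).
have wT : `|w T| <= c / B * (4 * M / alpha) * `|T - T'| `^ alpha.
  have aT1 := ltW aT; have aT'1 := ltW aT'.
  rewrite /w yT -yT' (Ey' T') ?lexx ?aT'1// (Ey' T) ?TT' ?aT1//.
  rewrite opprD addrACA subrr add0r -mulrBr normrM gtr0_norm// -[leRHS]mulrA ler_wpM2l ?(ltW cB0)//.
  rewrite distrC [`|T - T'|]distrC [`|T' - T|]ger0_norm ?subr_ge0// distrC.
  exact: abel_hoelder (ltW alpha_lt1) (ltW aT) TT' bg'.
apply: ub_ereal_sup => _ [t /= taT <-]; rewrite lee_fin.
rewrite in_itv/= in taT.
apply: le_trans (upper t taT) _.
rewrite -[leRHS]mulrA ler_wpM2l// -[leRHS]mulrA; apply: le_trans lower _.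
by rewrite ler_wpM2l.
Qed.
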